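(* Let $\phi\colon\mathbb{D}\to\mathbb{D}$ be an analytic self-map and assume there exists $w_0\in H^2$, $w_0\not\equiv0$, such that $M_{w_0}C_\phi\colon f\mapsto w_0\,(f\circ\phi)$ is a Hilbert–Schmidt operator on $H^2$. Then there exists $w\in H^2$, $w\not\equiv 0$, such that $M_wC_\phi$ is bounded on $H^2$ and $M_wC_\phi\in S_p(H^2)$ for every $p<2$ (with $p>0$).
   Context: $\mathbb{D}$ is the open unit disk, $H^2$ the Hardy space. $S_p(H^2)$, $p>0$, is the Schatten class of compact operators $T$ on $H^2$ with $\sum_n s_n(T)^p<\infty$ ($s_n$ the singular numbers). *)

(* Defs.v *)
From HB Require Import structures.
From mathcomp Require Import all_boot all_order all_algebra.
From mathcomp Require Import all_classical all_reals all_analysis.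
From mathcomp Require Import complex.
Set Implicit Arguments. Unset Strict Implicit. Unset Printing Implicit Defensive.
Import Order.TTheory GRing.Theory Num.Theory.
Import numFieldNormedType.Exports.
Local Open Scope ring_scope.
Local Open Scope classical_set_scope.

Definition cre {R : realType} (z : R[i]) : R := let: Complex a _ := z in a.
Definition cim {R : realType} (z : R[i]) : R := let: Complex _ b := z in b.
Definition cmod {R : realType} (z : R[i]) : R :=
  Num.sqrt (cre z ^+ 2 + cim z ^+ 2).

Definition inD {R : realType} (z : R[i]) : Prop := cmod z < 1.

Definition csums {R : realType} (u : nat -> R[i]) (l : R[i]) : Prop :=
  (fun n : nat => cmod (\sum_(k < n) u k - l)) @ \oo --> (0 : R).

Definition analytic_on_D {R : realType} (phi : R[i] -> R[i]) : Prop :=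
  forall a, inD a -> exists r : R, 0 < r /\ exists c : nat -> R[i],
    forall z, inD z -> cmod (z - a) < r ->
      csums (fun k => c k * (z - a) ^+ k) (phi z).

Definition analytic_selfmap {R : realType} (phi : R[i] -> R[i]) : Prop :=
  analytic_on_D phi /\ forall z, inD z -> inD (phi z).

(* Hardy space H^2: f(z) = sum_k a k z^k with sum_k |a k|^2 < oo;
   elements are represented by their Taylor coefficient sequences. *)
Definition sqpart {R : realType} (a : nat -> R[i]) (N : nat) : R :=
  \sum_(k < N) cmod (a k) ^+ 2.

Definition inH2 {R : realType} (a : nat -> R[i]) : Prop :=
  exists M : R, forall N, sqpart a N <= M.

Definition H2norm {R : realType} (a : nat -> R[i]) : R :=
  Num.sqrt (sup (range (sqpart a))).

Definition H2val {R : realType} (a : nat -> R[i]) (z v : R[i]) : Prop :=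
  csums (fun k => a k * z ^+ k) v.

(* (Possibly partially defined) operators on H^2, given as relations:
   T f g  means  "g = T f". *)
Definition H2op (R : realType) := (nat -> R[i]) -> (nat -> R[i]) -> Prop.

Definition wcomp {R : realType} (w : nat -> R[i]) (phi : R[i] -> R[i]) : H2op R :=
  fun f g => inH2 g /\ forall z, inD z -> exists fv wv,
      H2val f (phi z) fv /\ H2val w z wv /\ H2val g z (wv * fv).

Definition bounded_op {R : realType} (T : H2op R) : Prop :=
  exists M : R, forall f, inH2 f ->
    exists g, T f g /\ H2norm g <= M * H2norm f.

Definition ebasis {R : realType} (n : nat) : nat -> R[i] :=
  fun k => if k == n then 1 else 0.

Definition hilbert_schmidt {R : realType} (T : H2op R) : Prop :=
  bounded_op T /\ exists M : R, forall (N : nat) (g : nat -> nat -> R[i]),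
    (forall n, T (ebasis n) (g n)) -> \sum_(n < N) H2norm (g n) ^+ 2 <= M.

Definition lin_comb {R : realType} (n : nat) (c : 'I_n -> R[i])
  (v : 'I_n -> nat -> R[i]) : nat -> R[i] :=
  fun k => \sum_(i < n) c i * v i k.

Definition finrank_op {R : realType} (n : nat)
  (F : (nat -> R[i]) -> (nat -> R[i])) : Prop :=
  (forall f g (a : R[i]), inH2 f -> inH2 g ->
     F (fun k => a * f k + g k) = (fun k => a * F f k + F g k)) /\
  (exists M : R, forall f, inH2 f -> inH2 (F f) /\ H2norm (F f) <= M * H2norm f) /\
  (exists v : 'I_n -> nat -> R[i], (forall i, inH2 (v i)) /\
     forall f, inH2 f -> exists c, F f = lin_comb c v).

(* n-th approximation number (= n-th singular number s_n, n >= 0, for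
   operators on a Hilbert space): inf { ||T - F|| : rank F <= n } *)
Definition approx_num {R : realType} (T : H2op R) (n : nat) : R :=
  inf [set s : R | 0 <= s /\ exists F, finrank_op n F /\
        forall f g, inH2 f -> T f g ->
          H2norm (fun k => g k - F f k) <= s * H2norm f].

Definition schatten {R : realType} (p : R) (T : H2op R) : Prop :=
  bounded_op T /\ exists M : R, forall N : nat,
    \sum_(n < N) powR (approx_num T n) p <= M.

(* Main.v *)
Require Import Defs.
From HB Require Import structures.
From mathcomp Require Import all_boot all_order all_algebra.
From mathcomp Require Import all_solvable all_field.
From mathcomp Require Import all_classical all_reals all_analysis.
From mathcomp Require Import complex ring lra zify.
(** Let [g_n = w0 phi^n], so that the squared norms of the [g_n] are summable, and
    consider on circles of radius [r < 1] the weights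
    [W_N = eta + |w0|^2 (1 + |phi|^2 + ... + |phi|^(2N))].  Their logarithmic
    means increase with [N], and stay bounded by Jensen's inequality, since the
    [W_N] have bounded means and [w0] is not zero; hence, in the limit
    [r -> 1], [eta -> 0], the means of [ln W_N - ln W_(N_i)] are at most [2^-i]
    for all [N >= N_i] and a suitable sequence [N_i].  Szego's construction then
    yields [f] with [f(0) = 1] and [|f|^2] bounded by a constant times the product
    over [i < I] of [W_(N_i) / W_(N_I)].  As [W_(N_i) <= C_i W_0] and
    [W_N >= n |phi|^(2n) W_0] (up to [eta]) for [n <= N], the norms of the [f g_n]
    decay faster than any power of [n], uniformly in [I].  A coefficientwise limit
    of [f w0] as [I -> oo] is the weight [w]: truncating [sum_k a_k w phi^k] bounds
    the approximation numbers of [M_w C_phi] by a rapidly decreasing sequence.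

    No boundary values are used: the mean on the circle is a limit of averages over
    roots of unity, and all limits are taken along one ultrafilter. *)

Set Implicit Arguments. Unset Strict Implicit. Unset Printing Implicit Defensive.
Import Order.TTheory GRing.Theory Num.Theory.
Import numFieldNormedType.Exports.
Local Open Scope ring_scope.
Local Open Scope classical_set_scope.

(** * Modulus and limits along an ultrafilter *)

Section Modulus.
Variable R : realType.
Implicit Types (x y z : R[i]) (a b : R).

Lemma creD x y : cre (x + y) = cre x + cre y. Proof. by case: x y => ? ? []. Qed.
Lemma creN x : cre (- x) = - cre x. Proof. by case: x. Qed.
Lemma creB x y : cre (x - y) = cre x - cre y. Proof. by rewrite creD creN. Qed.
Lemma cimD x y : cim (x + y) = cim x + cim y. Proof. by case: x y => ? ? []. Qed.
Lemma cimN x : cim (- x) = - cim x. Proof. by case: x. Qed.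
Lemma cimB x y : cim (x - y) = cim x - cim y. Proof. by rewrite cimD cimN. Qed.
Lemma creM x y : cre (x * y) = cre x * cre y - cim x * cim y.
Proof. by case: x y => ? ? []. Qed.
Lemma cimM x y : cim (x * y) = cre x * cim y + cim x * cre y.
Proof. by case: x y => a b [c d] /=; rewrite mulrC. Qed.
Lemma cre_sum I (s : seq I) (P : pred I) (F : I -> R[i]) :
  cre (\sum_(i <- s | P i) F i) = \sum_(i <- s | P i) cre (F i).
Proof. exact: (big_morph _ creD). Qed.
Lemma cmodE z : cmod z = Normc.normc z. Proof. by case: z. Qed.
Lemma norm_cmod z : `|z| = (cmod z)%:C%C. Proof. by case: z. Qed.
Lemma cmod_ge0 z : 0 <= cmod z. Proof. exact: sqrtr_ge0. Qed.
Lemma cmod0 : cmod (0 : R[i]) = 0. Proof. by rewrite cmodE Normc.normc0. Qed.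
Lemma cmod1 : cmod (1 : R[i]) = 1. Proof. by rewrite cmodE Normc.normc1. Qed.
Lemma cmodM x y : cmod (x * y) = cmod x * cmod y.
Proof. by rewrite !cmodE Normc.normcM. Qed.
Lemma cmodX x n : cmod (x ^+ n) = cmod x ^+ n.
Proof. by elim: n => [|n IH]; rewrite ?expr0 ?cmod1 // !exprS cmodM IH. Qed.
Lemma cmodN x : cmod (- x) = cmod x.
Proof. by case: x => a b; rewrite /cmod /= !sqrrN. Qed.
Lemma cmodD x y : cmod (x + y) <= cmod x + cmod y.
Proof. by have := ler_normD x y; rewrite !norm_cmod -rmorphD /= lecR. Qed.
Lemma cmodB x y : cmod (x - y) = cmod (y - x).
Proof. by rewrite -cmodN opprB. Qed.
Lemma cmod_sum I (s : seq I) (P : pred I) (F : I -> R[i]) :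
  cmod (\sum_(i <- s | P i) F i) <= \sum_(i <- s | P i) cmod (F i).
Proof.
elim/big_ind2: _ => [|x1 x2 y1 y2 h1 h2|//]; first by rewrite cmod0.
exact: (le_trans (cmodD _ _) (lerD h1 h2)).
Qed.
Lemma cmod_eq0 x : cmod x = 0 -> x = 0.
Proof. by rewrite cmodE => /Normc.eq0_normc. Qed.
Lemma cmod_sq x : cmod x ^+ 2 = cre x ^+ 2 + cim x ^+ 2.
Proof. by rewrite sqr_sqrtr // addr_ge0 // sqr_ge0. Qed.
Lemma cre_le x : `|cre x| <= cmod x.
Proof.
by rewrite -sqrtr_sqr; apply: ler_wsqrtr; rewrite lerDl sqr_ge0.
Qed.
Lemma cim_le x : `|cim x| <= cmod x.
Proof.
by rewrite -sqrtr_sqr; apply: ler_wsqrtr; rewrite lerDr sqr_ge0.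
Qed.
Lemma cmod_real a : cmod (a%:C%C) = `|a|.
Proof. by rewrite /cmod /= expr0n /= addr0 sqrtr_sqr. Qed.
Lemma cmod_conj x : x * x^*%C = (cmod x ^+ 2)%:C%C.
Proof. by rewrite -sqr_normc norm_cmod rmorphXn. Qed.
Lemma cmod_sqD x y :
  cmod (x + y) ^+ 2 <= 2 * cmod x ^+ 2 + 2 * cmod y ^+ 2.
Proof.
have h : cmod (x + y) ^+ 2 <= (cmod x + cmod y) ^+ 2.
  by rewrite ler_pXn2r ?nnegrE ?addr_ge0 ?cmod_ge0 ?cmodD.
apply: (le_trans h); have := sqr_ge0 (cmod x - cmod y); nra.
Qed.

End Modulus.

(** * Limits of bounded real sequences along one fixed free ultrafilter *)

Section UltraLimit.

Lemma free_ultrafilter_subproof :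
  exists U : set_system nat, UltraFilter U /\ eventually `<=` U.
Proof. exact: ultraFilterLemma. Qed.

Definition free_ultrafilter := projT1 (cid free_ultrafilter_subproof).
Local Notation U := free_ultrafilter.
#[global] Instance free_ultrafilterP : UltraFilter U.
Proof. by rewrite /free_ultrafilter; case: cid => ? []. Qed.
Lemma eventually_ultra : eventually `<=` U.
Proof. by rewrite /free_ultrafilter; case: cid => ? []. Qed.
#[global] Instance free_ultrafilter_filter : ProperFilter U.
Proof. exact: ultra_proper. Qed.

Variable R : realType.
Implicit Types (u v : nat -> R).

Definition seq_bounded u := exists M, forall n, `|u n| <= M.
Definition ulim u : R := lim (u @ U).

(** For [A] in a finer proper filter [G], the ultrafilter [F] contains the preimage of [A] or its
    complement; the latter would put both [A] and its complement into [G]. *)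
Lemma ultra_fmap (S T : Type) (f : S -> T) (F : set_system S) :
  UltraFilter F -> UltraFilter (f @ F).
Proof.
move=> FU; have FP := @ultra_proper _ _ FU.
split; first exact: fmap_proper_filter.
move=> G GP FG; rewrite predeqE => A; split; last exact: FG.
move=> GA; have [//|FnA] := in_ultra_setVsetC (f @^-1` A) FU.
have GnA : G (~` A) by apply: FG.
have [x [Ax nAx]] := @filter_ex _ _ GP _ (@filterI _ _ GP _ _ GA GnA).
by [].
Qed.

(** The sequence lives in a compact segment, where every ultrafilter converges. *)
Lemma ulimP u : seq_bounded u -> u @ U --> ulim u.
Proof.
move=> [M uM].
have := @segment_compact R (- M) M; rewrite compact_ultra.
move=> /(_ (u @ U) (ultra_fmap u free_ultrafilterP)) [|l [_ ul]].
  apply: nearW => n /=; rewrite in_itv /= -ler_norml; exact: uM.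
by apply/cvg_ex; exists l.
Qed.

Lemma ulim_cvg u l : u @ U --> l -> ulim u = l.
Proof. by move=> /cvg_lim ul; apply: ul. Qed.
Lemma ulim_oo u l : u @ \oo --> l -> ulim u = l.
Proof. by move=> ul; apply: ulim_cvg => A /ul; apply: eventually_ultra. Qed.
Lemma ulim_cst (c : R) : ulim (fun=> c) = c.
Proof. by apply: ulim_cvg; exact: cvg_cst. Qed.
Lemma ulimD u v : seq_bounded u -> seq_bounded v ->
  ulim (fun n => u n + v n) = ulim u + ulim v.
Proof. by move=> /ulimP bu /ulimP bv; apply: ulim_cvg; apply: cvgD. Qed.
Lemma ulimZ (c : R) u : seq_bounded u -> ulim (fun n => c * u n) = c * ulim u.
Proof. by move=> /ulimP bu; apply: ulim_cvg; apply: cvgMr. Qed.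
Lemma ulim_le u v : seq_bounded u -> seq_bounded v ->
  (\forall n \near \oo, u n <= v n) -> ulim u <= ulim v.
Proof.
move=> /ulimP bu /ulimP bv uv.
by apply: (ler_cvg_to bu bv); apply: eventually_ultra.
Qed.
(** Both conditions hold on members of the ultrafilter, and two members always meet. This is how one
    index, as large as desired, is extracted from a bound on a limit. *)
Lemma ulim_near u (c : R) (n0 : nat) : seq_bounded u -> ulim u < c ->
  exists n, (n0 <= n)%N /\ u n < c.
Proof.
move=> /ulimP bu uc.
have h1 : U [set n | u n < c] by exact: (cvgr_lt _ bu).
have h2 : U [set n | (n0 <= n)%N] by apply: eventually_ultra; exists n0.
have [n [? ?]] := filter_ex (filterI h1 h2).
by exists n.
Qed.

Lemma seq_boundedD u v : seq_bounded u -> seq_bounded v ->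
  seq_bounded (fun n => u n + v n).
Proof.
move=> [M uM] [N vN]; exists (M + N) => n.
by rewrite (le_trans (ler_normD _ _)) ?lerD.
Qed.
Lemma seq_boundedZ (c : R) u : seq_bounded u -> seq_bounded (fun n => c * u n).
Proof.
move=> [M uM]; exists (`|c| * M) => n.
by rewrite normrM ler_wpM2l.
Qed.
Lemma seq_bounded_cst (c : R) : seq_bounded (fun=> c).
Proof. by exists `|c|. Qed.

End UltraLimit.

(** * Means on the unit circle *)

Section CircleMean.
Variable R : realType.
Implicit Types (z : R[i]) (u v : R[i] -> R) (P Q : {poly R[i]}).

(** The polynomial ['X^n - 1] splits and is separable, so it has [n] distinct roots; among so many
    [n]-th roots of unity one is primitive. *)
Lemma primitive_root_exists_complex n :
  (0 < n)%N -> exists z : R[i], n.-primitive_root z.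
Proof.
pose p : {poly R[i]} := 'X^n - 1; have [r Dp] := closed_field_poly_normal p.
move=> n_gt0; rewrite (monicP _) ?monicXnsubC // scale1r in Dp.
have rn1: all n.-unity_root r by apply/allP=> z; rewrite -root_prod_XsubC -Dp.
have sz_r: (n < (size r).+1)%N.
  by rewrite -(size_prod_XsubC r id) -Dp size_XnsubC.
have [|z] := hasP (has_prim_root n_gt0 rn1 _ sz_r); last by exists z.
by rewrite -separable_prod_XsubC -Dp separable_Xn_sub_1 // pnatr_eq0 -lt0n.
Qed.

Definition zroot (m : nat) : R[i] :=
  projT1 (cid (primitive_root_exists_complex (ltn0Sn m))).

Lemma zrootP m : m.+1.-primitive_root (zroot m).
Proof. by rewrite /zroot; case: cid. Qed.

Lemma cmod_zroot m i : cmod (zroot m ^+ i) = 1.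
Proof.
rewrite cmodX; suff -> : cmod (zroot m) = 1 by rewrite expr1n.
apply/eqP; rewrite -(@pexpr_eq1 _ _ m.+1) ?cmod_ge0 // -cmodX.
by rewrite (prim_expr_order (zrootP m)) cmod1.
Qed.

(** The sum is geometric with ratio [zroot m ^+ j], which differs from 1; multiplied by the ratio
    minus 1 it telescopes to zero. *)
Lemma sum_zroot m j : (j != 0 %[mod m.+1])%N ->
  \sum_(i < m.+1) (zroot m ^+ i) ^+ j = 0.
Proof.
move=> jm; have zP := zrootP m.
have x1 : zroot m ^+ j - 1 != 0.
  by rewrite subr_eq0 -[1](expr0 (zroot m)) (eq_prim_root_expr zP).
apply: (mulfI x1); rewrite mulr0.
under eq_bigr do rewrite exprAC.
by rewrite -subrX1 -exprM mulnC exprM (prim_expr_order zP) expr1n subrr.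
Qed.

Lemma conj_unit z : cmod z = 1 -> z^*%C * z = 1.
Proof. by move=> z1; rewrite mulrC cmod_conj z1 expr1n. Qed.

(** On the circle conjugation is inversion, and for an [m.+1]-th root of unity the exponent [- l]
    may be replaced by [m * l]. The bounds on [k] and [l] turn congruence modulo [m.+1] into
    equality. *)
Lemma sum_zroot_conj m (k l : nat) : (k <= m)%N -> (l <= m)%N ->
  \sum_(i < m.+1) (zroot m ^+ i) ^+ k * ((zroot m ^+ i) ^+ l)^*%C =
  if k == l then m.+1%:R else 0.
Proof.
move=> km lm; have zP := zrootP m.
have e i : (zroot m ^+ i) ^+ k * ((zroot m ^+ i) ^+ l)^*%C =
  (zroot m ^+ i) ^+ (k + m * l).
  set x := zroot m ^+ i; have x1 : cmod (x ^+ l) = 1 by rewrite -exprM cmod_zroot.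
  have xl : x ^+ l * x ^+ (m * l) = 1.
    by rewrite -exprD -mulSn exprM /x (exprAC _ i) (prim_expr_order zP) !expr1n.
  have xl0 : x ^+ l != 0 by apply: contra_eq_neq x1 => ->; rewrite cmod0 eq_sym oner_eq0.
  rewrite exprD; congr (_ * _); apply: (mulfI xl0).
  by rewrite xl mulrC conj_unit.
under eq_bigr do rewrite e.
have [->|kl] := eqVneq k l.
  under eq_bigr => i _.
    rewrite -mulSn exprM (exprAC _ i) (prim_expr_order zP) !expr1n; over.
  by rewrite sumr_const card_ord.
apply: sum_zroot; apply: contra kl => /eqP h.
have {}h : k = l %[mod m.+1].
  have -> : (l %% m.+1 = (k + m * l + l) %% m.+1)%N.
    by rewrite -modnDml h mod0n add0n.
  by rewrite -addnA addnC -mulSnr mulnC modnMDl.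
by move: h; rewrite !modn_small // => ->.
Qed.

Definition avg (m : nat) u : R := (\sum_(i < m.+1) u (zroot m ^+ i)) / m.+1%:R.

Lemma avg_cre_poly m Q : (size Q <= m.+1)%N ->
  avg m (fun z => cre Q.[z]) = cre Q`_0.
Proof.
move=> sQ; rewrite /avg -cre_sum.
under eq_bigr do rewrite (horner_coef_wide _ sQ).
rewrite exchange_big /= big_ord_recl /=.
rewrite [X in _ + X]big1 => [|j _].
  under eq_bigr do rewrite expr0 mulr1.
  rewrite addr0 sumr_const card_ord -[_ *+ _]mulr_natr creM.
  have -> : (m.+1%:R : R[i]) = (m.+1%:R : R)%:C%C by rewrite rmorph_nat.
  by rewrite /= mulr0 subr0 mulfK // pnatr_eq0.
rewrite -mulr_sumr sum_zroot ?mulr0 //.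
by rewrite /bump /= !modn_small // ltnS.
Qed.

(** Discrete Parseval identity: [m.+1] nodes make the monomials of degree at most [m]
    orthonormal. *)
Lemma avg_cmod_poly m n Q : (size Q <= n)%N -> (n <= m.+1)%N ->
  avg m (fun z => cmod Q.[z] ^+ 2) = \sum_(k < n) cmod Q`_k ^+ 2.
Proof.
move=> sQ nm; rewrite /avg; apply: (canLR (mulfK _)); first by rewrite pnatr_eq0.
apply: (@complexI R); rewrite rmorphM /= !rmorph_sum /= rmorph_nat.
under eq_bigr do rewrite -cmod_conj (horner_coef_wide _ sQ) rmorph_sum mulr_suml.
under eq_bigr => i _.
  under eq_bigr do rewrite mulr_sumr.
  over.
rewrite exchange_big /= mulr_suml; apply: eq_bigr => k _.
rewrite exchange_big /= (bigD1 k) //= [X in _ + X]big1 => [|l lk].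
  rewrite addr0 -cmod_conj.
  under eq_bigr do rewrite rmorphM mulrACA.
  rewrite -mulr_sumr sum_zroot_conj ?eqxx //; rewrite -ltnS; exact: leq_trans nm.
under eq_bigr do rewrite rmorphM mulrACA.
rewrite -mulr_sumr sum_zroot_conj ?(leq_trans _ nm) -1?ltnS ?(leq_trans _ nm) //.
by rewrite eq_sym (negbTE (lk : (l : nat) != k)) mulr0.
Qed.

Definition bounded_circle u := exists M, forall z, cmod z = 1 -> `|u z| <= M.

(** A positive linear functional on all bounded functions on the circle. On real parts and squared
    moduli of polynomials the averages are eventually constant, so it agrees there with the integral
    mean. *)
Definition cmean u : R := ulim (fun m => avg m u).

Lemma avg_le m u v : (forall z, cmod z = 1 -> u z <= v z) -> avg m u <= avg m v.
Proof.
move=> uv; rewrite /avg ler_pM2r ?invr_gt0 ?ltr0Sn //.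
by apply: ler_sum => i _; apply: uv; rewrite cmod_zroot.
Qed.

Lemma avg_cst m (c : R) : avg m (fun=> c) = c.
Proof. by rewrite /avg sumr_const card_ord -[c *+ _]mulr_natr mulfK // pnatr_eq0. Qed.

Lemma avg_bounded u : bounded_circle u -> seq_bounded (fun m => avg m u).
Proof.
move=> [M uM]; exists M => m; rewrite ler_norml; apply/andP; split.
  rewrite -[leLHS](avg_cst m); apply: avg_le => z /uM.
  by rewrite ler_norml => /andP[].
rewrite -[leRHS](avg_cst m); apply: avg_le => z /uM.
by rewrite ler_norml => /andP[].
Qed.

Lemma cmeanD u v : bounded_circle u -> bounded_circle v ->
  cmean (fun z => u z + v z) = cmean u + cmean v.
Proof.
move=> bu bv; rewrite /cmean -ulimD; try exact: avg_bounded.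
by congr ulim; apply/funext => m; rewrite /avg big_split mulrDl.
Qed.

Lemma cmeanZ (c : R) u : bounded_circle u ->
  cmean (fun z => c * u z) = c * cmean u.
Proof.
move=> bu; rewrite /cmean -ulimZ; try exact: avg_bounded.
by congr ulim; apply/funext => m; rewrite /avg -mulr_sumr mulrA.
Qed.

Lemma cmean_le u v : bounded_circle u -> bounded_circle v ->
  (forall z, cmod z = 1 -> u z <= v z) -> cmean u <= cmean v.
Proof.
move=> bu bv uv; apply: ulim_le; try exact: avg_bounded.
by apply: nearW => m; apply: avg_le.
Qed.

Lemma cmean_cst (c : R) : cmean (fun=> c) = c.
Proof.
rewrite /cmean -[RHS](ulim_cst c); congr ulim; apply/funext => m.
exact: avg_cst.
Qed.

Lemma cmean_cre_poly Q : cmean (fun z => cre Q.[z]) = cre Q`_0.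
Proof.
apply: ulim_oo; apply: cvg_near_cst.
by near=> m; rewrite avg_cre_poly //; near: m; exists (size Q) => // m /leqW.
Unshelve. all: by end_near. Qed.

Lemma cmean_cmod_poly n Q : (size Q <= n)%N ->
  cmean (fun z => cmod Q.[z] ^+ 2) = \sum_(k < n) cmod Q`_k ^+ 2.
Proof.
move=> sQ; apply: ulim_oo; apply: cvg_near_cst.
by near=> m; rewrite (avg_cmod_poly sQ) //; near: m; exists n => // m /leqW.
Unshelve. all: by end_near. Qed.

Lemma poly_bounded_circle Q :
  exists2 M : R, 0 <= M & forall z, cmod z = 1 -> cmod Q.[z] <= M.
Proof.
exists (\sum_(i < size Q) cmod Q`_i); first by apply: sumr_ge0 => i _; exact: cmod_ge0.
move=> z z1; rewrite horner_coef; apply: (le_trans (cmod_sum _ _ _)).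
by apply: ler_sum => i _; rewrite cmodM cmodX z1 expr1n mulr1.
Qed.

Lemma bounded_circle_cre Q : bounded_circle (fun z => cre Q.[z]).
Proof.
have [M _ QM] := poly_bounded_circle Q; exists M => z /QM.
exact/le_trans/cre_le.
Qed.

Lemma bounded_circle_cmod Q : bounded_circle (fun z => cmod Q.[z] ^+ 2).
Proof.
have [M M0 QM] := poly_bounded_circle Q; exists (M ^+ 2) => z /QM zM.
by rewrite ger0_norm ?sqr_ge0 // ler_pXn2r ?nnegrE ?cmod_ge0.
Qed.

Lemma bessel_cmean Q K :
  \sum_(k < K) cmod Q`_k ^+ 2 <= cmean (fun z => cmod Q.[z] ^+ 2).
Proof.
have [sQK|KsQ] := leqP (size Q) K; first by rewrite (cmean_cmod_poly sQK).
rewrite (cmean_cmod_poly (leqnn _)) -!(big_mkord xpredT (fun k => cmod Q`_k ^+ 2)).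
by rewrite (big_cat_nat (leq0n _) (ltnW KsQ)) //= lerDl sumr_ge0 // => i _; exact: sqr_ge0.
Qed.

Lemma bessel_poly Q (c : R) K :
  (forall z, cmod z = 1 -> cmod Q.[z] ^+ 2 <= c) ->
  \sum_(k < K) cmod Q`_k ^+ 2 <= c.
Proof.
move=> Qc; apply: (le_trans (bessel_cmean _ _)).
rewrite -[leRHS]cmean_cst; apply: cmean_le => //; first exact: bounded_circle_cmod.
by exists `|c|.
Qed.

Lemma bounded_circleD u v : bounded_circle u -> bounded_circle v ->
  bounded_circle (fun z => u z + v z).
Proof.
move=> [M uM] [N vN]; exists (M + N) => n n1.
by rewrite (le_trans (ler_normD _ _)) ?lerD ?uM ?vN.
Qed.
Lemma bounded_circleZ (c : R) u : bounded_circle u ->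
  bounded_circle (fun z => c * u z).
Proof.
move=> [M uM]; exists (`|c| * M) => n n1.
by rewrite normrM ler_wpM2l // uM.
Qed.
Lemma bounded_circle_cst (c : R) : bounded_circle (fun=> c).
Proof. by exists `|c|. Qed.

(** Both conclusions are proved in one induction because additivity of [cmean] at each step asks for
    boundedness of the partial sum. *)
Lemma cmean_sum (I : Type) (s : seq I) (F : I -> R[i] -> R) :
  (forall i, bounded_circle (F i)) ->
  bounded_circle (fun z => \sum_(i <- s) F i z) /\
  cmean (fun z => \sum_(i <- s) F i z) = \sum_(i <- s) cmean (F i).
Proof.
move=> bF; elim: s => [|i s [bs ms]].
  have -> : (fun z => \sum_(i <- [::]) F i z) = fun=> 0.
    by apply/funext => z; rewrite big_nil.
  by rewrite big_nil cmean_cst; split => //; exact: bounded_circle_cst.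
have -> : (fun z => \sum_(j <- i :: s) F j z) =
          (fun z => F i z + \sum_(j <- s) F j z).
  by apply/funext => z; rewrite big_cons.
by rewrite big_cons cmeanD // ms; split => //; exact: bounded_circleD.
Qed.

End CircleMean.

(** * Trigonometric approximation and the Szego polynomial *)

Section LogSeries.
Variable R : realType.

(** Remainder after [K] terms of the logarithmic series of [ln (1 - y)]. *)
Definition ln_rem (K : nat) (y : R) : R :=
  ln (1 - y) + \sum_(k < K) y ^+ k.+1 / k.+1%:R.

Lemma is_derive_ln_rem K (y : R) : y < 1 ->
  is_derive y 1 (ln_rem K) (- (y ^+ K / (1 - y))).
Proof.
move=> y1; elim: K => [|K IH].
  have -> : ln_rem 0 = (@ln R) \o (fun y => 1 - y).
    by apply/funext => x; rewrite /ln_rem big_ord0 addr0.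
  have h : is_derive (1 - y) 1 (@ln R) (1 - y)^-1.
    by apply: is_derive1_ln; rewrite subr_gt0.
  apply: is_derive_eq.
  rewrite expr0 div1r /GRing.scale /=. by ring.
have -> : ln_rem K.+1 = ln_rem K + (K.+1%:R^-1 \*: (@id R ^+ K.+1)).
  apply/funext => x; rewrite /ln_rem big_ord_recr /= addrA [_ / _]mulrC.
  by rewrite exprfctE.
apply: is_derive_eq; rewrite /GRing.scale /=.
have y1' : 1 - y != 0 by rewrite subr_eq0 eq_sym lt_eqF.
by rewrite exprS; field; rewrite y1' addrC natr1 pnatr_eq0.
Qed.

(** Mean value theorem on [[0, y]]: the remainder vanishes at 0, and its derivative is known in
    closed form because the derivative of the partial sum is geometric. *)
Lemma ln_rem_le K (rho y : R) : 0 <= y -> y <= rho -> rho < 1 ->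
  `|ln_rem K y| <= rho ^+ K / (1 - rho).
Proof.
move=> y0 yr r1.
have dh x : x \in `]0, y[%R -> is_derive x 1 (ln_rem K) (- (x ^+ K / (1 - x))).
  by rewrite in_itv /= => /andP[_ xy]; apply: is_derive_ln_rem; lra.
have ch : {within `[0, y], continuous (ln_rem K)}.
  apply: derivable_within_continuous => x; rewrite in_itv /= => /andP[_ xy].
  have /is_derive_ln_rem h : x < 1 by lra.
  exact: (@ex_derive _ _ _ _ _ _ _ (h K)).
have [c] := MVT_segment y0 dh ch.
rewrite in_itv /= => /andP[c0 cy].
have -> : ln_rem K 0 = 0.
  by rewrite /ln_rem subr0 ln1 big1 ?addr0 // => i _; rewrite exprS !mul0r.
rewrite !subr0 => ->; rewrite normrM normrN (ger0_norm y0) ger0_norm; last first.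
  by apply: divr_ge0; [exact: exprn_ge0|lra].
rewrite -[leRHS]mulr1; apply: ler_pM; rewrite ?divr_ge0 ?exprn_ge0 //; try lra.
apply: ler_pM; rewrite ?exprn_ge0 ?invr_ge0 //; try lra.
  by apply: lerXn2r; rewrite ?nnegrE //; lra.
by rewrite lef_pV2 ?posrE; lra.
Qed.

End LogSeries.

Lemma expr_small (R : realType) (rho e : R) : 0 <= rho -> rho < 1 -> 0 < e ->
  exists K, forall n, (K <= n)%N -> rho ^+ n <= e.
Proof.
move=> r0 r1 e0; have : `|rho| < 1 by rewrite ger0_norm.
move=> /cvg_expr /cvgrPdist_le /(_ _ e0) [K _ h]; exists K => n Kn.
by have := h n Kn; rewrite /= sub0r normrN ger0_norm ?exprn_ge0.
Qed.

(** * Uniform approximation by trigonometric polynomials on the circle *)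

Section TrigApprox.
Variable R : realType.
Implicit Types (z : R[i]) (u v : R[i] -> R) (P Q : {poly R[i]}).

Definition trig_exact u := exists Q, forall z, cmod z = 1 -> u z = cre Q.[z].

Lemma trig_exact_sum n (F : 'I_n -> R[i] -> R) :
  (forall i, trig_exact (F i)) -> trig_exact (fun z => \sum_(i < n) F i z).
Proof.
elim: n F => [|n IH] F tF.
  by exists 0 => z _; rewrite big_ord0 horner0.
have [Q hQ] := IH (fun i => F (widen_ord (leqnSn n) i)) (fun i => tF _).
have [P hP] := tF ord_max.
by exists (Q + P) => z z1; rewrite big_ord_recr hornerD creD -hQ // -hP.
Qed.

Lemma creM_half (x y : R[i]) :
  cre x * cre y = cre ((2^-1)%:C%C * (x * y + x * y^*%C)).
Proof. by case: x y => [a b] [c d] /=; field. Qed.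

(** After [creM_half] the only non-analytic factor is [z ^+ i] times the conjugate of [z ^+ j],
    which on the circle is [z ^+ (i - j)]; the order of [i] and [j] makes this a genuine power. *)
Lemma trig_exact_monomial (a b : R[i]) i j : (j <= i)%N ->
  trig_exact (fun z => cre (a * z ^+ i) * cre (b * z ^+ j)).
Proof.
move=> ji.
exists ((2^-1)%:C%C%:P * ((a * b) *: 'X^(i + j) + (a * b^*%C) *: 'X^(i - j))) => z z1.
rewrite creM_half hornerM hornerC hornerD !hornerZ !hornerXn; congr (cre (_ * (_ + _))).
  by rewrite exprD mulrACA.
have e : z ^+ i * (z ^+ j)^*%C = z ^+ (i - j).
  rewrite -{1}(subnK ji) exprD -mulrA cmod_conj cmodX z1 !expr1n.
  by rewrite (_ : 1%:C%C = 1) // mulr1.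
by rewrite rmorphM /= mulrACA e.
Qed.

Lemma trig_exactM P Q : trig_exact (fun z => cre P.[z] * cre Q.[z]).
Proof.
have [S hS] : trig_exact (fun z => \sum_(i < size P) \sum_(j < size Q)
    cre (P`_i * z ^+ i) * cre (Q`_j * z ^+ j)).
  apply: trig_exact_sum => i; apply: trig_exact_sum => j.
  have [ji|/ltnW ij] := leqP j i; first exact: trig_exact_monomial.
  have [S hS] := trig_exact_monomial Q`_j P`_i ij.
  by exists S => z /hS <-; rewrite mulrC.
exists S => z z1; rewrite -hS // !horner_coef !cre_sum mulr_suml.
by apply: eq_bigr => i _; rewrite mulr_sumr.
Qed.

(** The uniform closure of the real trigonometric polynomials, playing the part of continuity on the
    circle. *)
Definition trig_approx u := forall e : R, 0 < e ->
  exists Q, forall z, cmod z = 1 -> `|u z - cre Q.[z]| <= e.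

Lemma trig_approx_poly Q : trig_approx (fun z => cre Q.[z]).
Proof. by move=> e e0; exists Q => z _; rewrite subrr normr0 ltW. Qed.

Lemma trig_approx_lim u :
  (forall e, 0 < e -> exists v, trig_approx v /\
     forall z, cmod z = 1 -> `|u z - v z| <= e) -> trig_approx u.
Proof.
move=> h e e0; have e2 : 0 < e / 2 by lra.
have [v [/(_ _ e2) [Q hQ] uv]] := h _ e2; exists Q => z z1.
rewrite (_ : _ - _ = u z - v z + (v z - cre Q.[z])); last by ring.
by apply: (le_trans (ler_normD _ _)); have := hQ _ z1; have := uv _ z1; lra.
Qed.

Lemma trig_approx_bounded u : trig_approx u -> bounded_circle u.
Proof.
move=> /(_ 1 ltr01) [Q hQ]; have [M hM] := bounded_circle_cre Q.
exists (1 + M) => z z1; rewrite -[u z](subrK (cre Q.[z])).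
by apply: (le_trans (ler_normD _ _)); apply: lerD; [exact: hQ|exact: hM].
Qed.

Lemma trig_approx_cst (c : R) : trig_approx (fun=> c).
Proof. by move=> e e0; exists (c%:C%C)%:P => z _; rewrite hornerC /= subrr normr0 ltW. Qed.

Lemma trig_approxD u v : trig_approx u -> trig_approx v ->
  trig_approx (fun z => u z + v z).
Proof.
move=> hu hv e e0; have e2 : 0 < e / 2 by lra.
have [P hP] := hu _ e2; have [Q hQ] := hv _ e2; exists (P + Q) => z z1.
rewrite hornerD creD (_ : _ - _ = u z - cre P.[z] + (v z - cre Q.[z])); last by ring.
by apply: (le_trans (ler_normD _ _)); have := hP _ z1; have := hQ _ z1; lra.
Qed.

Lemma trig_approxM u v : trig_approx u -> trig_approx v ->
  trig_approx (fun z => u z * v z).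
Proof.
move=> hu hv e e0.
have [M hM] := trig_approx_bounded hu.
have M0 : 0 <= M by apply: le_trans (hM 1 (cmod1 R)).
have e1 : 0 < e / (2 * (M + 1)) by apply: divr_gt0 => //; lra.
have [Q hQ] := hv _ e1; have [N hN] := bounded_circle_cre Q.
have N0 : 0 <= N by apply: le_trans (hN 1 (cmod1 R)).
have e2 : 0 < e / (2 * (N + 1)) by apply: divr_gt0 => //; lra.
have [P hP] := hu _ e2; have [S hS] := trig_exactM P Q.
exists S => z z1; rewrite -hS //.
rewrite (_ : _ - _ = u z * (v z - cre Q.[z]) + (u z - cre P.[z]) * cre Q.[z]); last by ring.
apply: (le_trans (ler_normD _ _)); rewrite !normrM.
have a1 : `|u z| * `|v z - cre Q.[z]| <= M * (e / (2 * (M + 1))).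
  by apply: ler_pM => //; [exact: hM|exact: hQ].
have a2 : `|u z - cre P.[z]| * `|cre Q.[z]| <= e / (2 * (N + 1)) * N.
  by apply: ler_pM => //; [exact: hP|exact: hN].
have b1 : M * (e / (2 * (M + 1))) <= e / 2.
  by rewrite mulrA ler_pdivrMr; [nra|lra].
have b2 : e / (2 * (N + 1)) * N <= e / 2.
  by rewrite mulrAC ler_pdivrMr; [nra|lra].
lra.
Qed.

Lemma trig_approxX u n : trig_approx u -> trig_approx (fun z => u z ^+ n).
Proof.
move=> hu; elim: n => [|n IH]; first by under eq_fun do rewrite expr0; exact: trig_approx_cst.
by under eq_fun do rewrite exprS; exact: trig_approxM.
Qed.

Lemma trig_approx_sum n (F : nat -> R[i] -> R) :
  (forall i, trig_approx (F i)) -> trig_approx (fun z => \sum_(i < n) F i z).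
Proof.
move=> hF; elim: n => [|n IH].
  by under eq_fun do rewrite big_ord0; exact: trig_approx_cst.
by under eq_fun do rewrite big_ord_recr; exact: trig_approxD.
Qed.

Lemma trig_approxZ (c : R) u : trig_approx u -> trig_approx (fun z => c * u z).
Proof. by move=> hu; apply: trig_approxM => //; exact: trig_approx_cst. Qed.

(** Write [u = b * (1 - y)] with [0 <= y <= 1 - a / b < 1]: the logarithmic series converges
    uniformly in [y], and its partial sums are polynomials in [u]. *)
Lemma trig_approx_ln u (a b : R) : 0 < a ->
  (forall z, cmod z = 1 -> a <= u z <= b) ->
  trig_approx u -> trig_approx (fun z => ln (u z)).
Proof.
move=> a0 uab hu.
have b0 : 0 < b by have /andP[] := uab 1 (cmod1 R); lra.
have ab1 : 0 < a / b by exact: divr_gt0.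
pose rho := 1 - a / b; pose y z := 1 - u z / b.
have ry z : cmod z = 1 -> 0 <= y z /\ y z <= rho.
  move=> /uab /andP[au ub]; rewrite /y /rho; split.
    by rewrite subr_ge0 ler_pdivrMr // mul1r.
  by rewrite lerD2l lerN2 ler_pM2r ?invr_gt0.
have r1 : rho < 1 by rewrite /rho; lra.
have r0 : 0 <= rho by have [] := ry 1 (cmod1 R); lra.
apply: trig_approx_lim => e e0.
have [K hK] := expr_small r0 r1 (mulr_gt0 e0 (ltac:(lra) : 0 < 1 - rho)).
exists (fun z => ln b + -1 * \sum_(k < K) (k.+1%:R^-1 * y z ^+ k.+1)); split.
  apply: trig_approxD; first exact: trig_approx_cst.
  apply: trig_approxZ; apply: (@trig_approx_sum K (fun k z => k.+1%:R^-1 * y z ^+ k.+1)) => k.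
  apply: trig_approxZ; apply: trig_approxX.
  apply: trig_approxD; first exact: trig_approx_cst.
  have -> : (fun z => - (u z / b)) = (fun z => (- b^-1) * u z).
    by apply/funext => z; ring.
  exact: trig_approxZ.
move=> z z1; have [y0 yr] := ry z z1.
have := ln_rem_le K y0 yr r1.
have -> : ln_rem K (y z) =
    ln (u z) - (ln b + -1 * \sum_(k < K) (k.+1%:R^-1 * y z ^+ k.+1)).
  have uz : u z = b * (1 - y z) by rewrite /y; field; rewrite gt_eqF.
  have y1 : 0 < 1 - y z by lra.
  rewrite {1}uz lnM ?posrE // /ln_rem.
  have -> : \sum_(k < K) y z ^+ k.+1 / k.+1%:R = \sum_(k < K) (k.+1%:R^-1 * y z ^+ k.+1).
    by apply: eq_bigr => k _; rewrite mulrC.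
  by ring.
move=> h; apply: (le_trans h); rewrite ler_pdivrMr; [exact: hK|lra].
Qed.

(* The polynomial [(1 - (Q - Q(0)) / (2 n)) ^ n] replaces [exp (- (Q - Q(0)) / 2)]:
   only the upper bound [1 + x <= exp x] is needed for its modulus. *)
Lemma szego_poly u (d : R) : trig_approx u -> 0 < d ->
  exists f : {poly R[i]}, f`_0 = 1 /\
    forall z, cmod z = 1 -> cmod f.[z] ^+ 2 <= expR (cmean u - u z + d).
Proof.
move=> hu d0; have d4 : 0 < d / 4 by lra.
have [Q hQ] := hu _ d4.
pose q := Q - (Q`_0)%:P.
have Lu : cre Q`_0 <= cmean u + d / 4.
  rewrite -cmean_cre_poly -[X in _ + X]cmean_cst -cmeanD; last 2 first.
  - exact: trig_approx_bounded.
  - exact: bounded_circle_cst.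
  apply: cmean_le; first exact: bounded_circle_cre.
    by apply: bounded_circleD; [exact: trig_approx_bounded|exact: bounded_circle_cst].
  by move=> z /hQ; rewrite ler_norml => /andP[]; lra.
have [M M0 hM] := poly_bounded_circle q.
(* With [n] above [M ^+ 2 / d], the quadratic term [c * cmod x ^+ 2 / 2] of the exponent costs at
   most [d / 2]. The approximation by [Q] costs [d / 4] twice, once in the mean and once at [z]. *)
pose n := (Num.truncn (M ^+ 2 / d)).+1.
have nM : M ^+ 2 / d < n%:R by exact: truncnS_gt.
have n0 : 0 < n%:R :> R by rewrite ltr0n.
pose c : R := (2 * n%:R)^-1.
have c0 : 0 < c by rewrite invr_gt0; lra.
have qE t : q.[t] = Q.[t] - Q`_0 by rewrite /q hornerD hornerN hornerC.
have fE t : (1 - c%:C%C *: q).[t] = 1 - c%:C%C * q.[t].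
  by rewrite hornerD hornerN hornerZ -[1]/(1%:P) hornerC.
exists ((1 - c%:C%C *: q) ^+ n); split.
  by rewrite -horner_coef0 horner_exp fE qE horner_coef0 subrr mulr0 subr0 expr1n.
move=> z z1; rewrite horner_exp cmodX -exprM mulnC exprM.
rewrite fE; set x := q.[z].
have xM : cmod x ^+ 2 <= M ^+ 2 by rewrite ler_pXn2r ?nnegrE ?cmod_ge0 ?hM.
have e1 : cmod (1 - c%:C%C * x) ^+ 2 = 1 - 2 * c * cre x + c ^+ 2 * cmod x ^+ 2.
  by rewrite !cmod_sq creB cimB creM cimM /=; ring.
have e2 : cmod (1 - c%:C%C * x) ^+ 2 <= expR (- 2 * c * cre x + c ^+ 2 * cmod x ^+ 2).
  by rewrite e1; apply: le_trans (expR_ge1Dx _); lra.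
have e3 : (cmod (1 - c%:C%C * x) ^+ 2) ^+ n <=
   expR (- 2 * c * cre x + c ^+ 2 * cmod x ^+ 2) ^+ n.
  by apply: lerXn2r; rewrite ?nnegrE ?sqr_ge0 ?expR_ge0.
apply: (le_trans e3); rewrite -expRM_natl ler_expR.
have xre : cre x = cre Q.[z] - cre Q`_0 by rewrite /x qE creB.
have cn : n%:R * (2 * c) = 1 by rewrite /c; field; rewrite gt_eqF.
have -> : n%:R * (- 2 * c * cre x + c ^+ 2 * cmod x ^+ 2) =
   - (n%:R * (2 * c)) * cre x + (n%:R * (2 * c)) * c * cmod x ^+ 2 / 2 by field.
rewrite cn xre.
have cM : c * M ^+ 2 <= d.
  rewrite /c mulrC ler_pdivrMr; last by lra.
  by move: nM; rewrite ltr_pdivrMr // => nM; nra.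
have cx : c * cmod x ^+ 2 <= c * M ^+ 2 by rewrite ler_pM2l.
by have := hQ _ z1; rewrite ler_norml => /andP[]; lra.
Qed.

End TrigApprox.

(** * Power series and coefficient sequences *)

Section PowerSeries.
Variable R : realType.
Implicit Types (f g : nat -> R[i]) (z v : R[i]) (B : R).

Definition psum f z d : R[i] := \sum_(k < d) f k * z ^+ k.

Lemma psumD f g z d : psum (fun k => f k + g k) z d = psum f z d + psum g z d.
Proof. by rewrite /psum -big_split; apply: eq_bigr => k _; rewrite mulrDl. Qed.

Lemma psumZ a f z d : psum (fun k => a * f k) z d = a * psum f z d.
Proof. by rewrite /psum mulr_sumr; apply: eq_bigr => k _; rewrite mulrA. Qed.

Lemma geo_sum (x : R) d n : 0 <= x -> x < 1 ->
  \sum_(d <= k < d + n) x ^+ k <= x ^+ d / (1 - x).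
Proof.
move=> x0 x1; have x1' : 0 < 1 - x by lra.
have -> : \sum_(d <= k < d + n) x ^+ k = x ^+ d * \sum_(k < n) x ^+ k.
  rewrite -{1}[d]add0n [X in index_iota _ X]addnC big_addn addnK big_mkord mulr_sumr.
  by apply: eq_bigr => k _; rewrite exprD mulrC.
apply: ler_wpM2l; first exact: exprn_ge0.
rewrite -[leRHS]mul1r ler_pdivlMr // mulrC -[1 - x]opprB mulNr -subrX1.
by have := exprn_ge0 n x0; lra.
Qed.

Lemma psum_diff f z B d e : (forall k, cmod (f k) <= B) -> cmod z < 1 ->
  (d <= e)%N -> cmod (psum f z e - psum f z d) <= B * (cmod z ^+ d / (1 - cmod z)).
Proof.
move=> fB z1 de; have B0 : 0 <= B by exact: le_trans (cmod_ge0 _) (fB 0).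
rewrite /psum -!(big_mkord xpredT (fun k => f k * z ^+ k)).
rewrite (big_cat_nat (leq0n d) de) /= addrAC subrr add0r.
apply: (le_trans (cmod_sum _ _ _)).
apply: (@le_trans _ _ (\sum_(d <= k < e) B * cmod z ^+ k)).
  by apply: ler_sum => k _; rewrite cmodM cmodX ler_wpM2r ?exprn_ge0 ?cmod_ge0.
rewrite -mulr_sumr ler_wpM2l // -(subnKC de); apply: geo_sum => //; exact: cmod_ge0.
Qed.

Lemma H2valP f z v : H2val f z v <->
  (fun n => cmod (psum f z n - v)) @ \oo --> (0 : R).
Proof. by []. Qed.

Lemma le_of_cvg0 (x : R) (u : nat -> R) :
  u @ \oo --> (0 : R) -> (forall n, x <= u n) -> x <= 0.
Proof.
move=> u0 xu; apply: (ler_cvg_to (cvg_cst x) u0); exact: nearW.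
Qed.

Lemma cvg0_le (u v : nat -> R) : (forall n, 0 <= u n <= v n) ->
  v @ \oo --> (0 : R) -> u @ \oo --> (0 : R).
Proof.
move=> uv v0; apply: (squeeze_cvgr _ (cvg_cst 0) v0); exact: nearW.
Qed.

Lemma cvg0D (u v : nat -> R) : u @ \oo --> (0 : R) -> v @ \oo --> (0 : R) ->
  (fun n => u n + v n) @ \oo --> (0 : R).
Proof. by move=> hu hv; rewrite -[X in _ --> X]addr0; exact: cvgD. Qed.

Lemma cvg0Z (c : R) (u : nat -> R) : u @ \oo --> (0 : R) ->
  (fun n => c * u n) @ \oo --> (0 : R).
Proof. by move=> hu; rewrite -[X in _ --> X](mulr0 c); exact: cvgMr. Qed.

Lemma H2val_uniq f z v w : H2val f z v -> H2val f z w -> v = w.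
Proof.
move=> hv hw; apply/eqP; rewrite -subr_eq0; apply/eqP/cmod_eq0/le_anti.
rewrite cmod_ge0 andbT.
apply: (le_of_cvg0 (cvg0D hv hw)) => n; rewrite -/(psum f z n).
have -> : v - w = (psum f z n - w) - (psum f z n - v) by ring.
by rewrite addrC; apply: le_trans (cmodD _ _) _; rewrite cmodN.
Qed.

(** Limit of [psum_diff] in its upper index. The estimate sees [f] only through [B], so a truncation
    degree can serve a whole family of series. *)
Lemma H2val_tail f z v B d : (forall k, cmod (f k) <= B) -> cmod z < 1 ->
  H2val f z v -> cmod (v - psum f z d) <= B * (cmod z ^+ d / (1 - cmod z)).
Proof.
move=> fB z1 hv; rewrite -subr_le0.
apply: (ler_cvg_to (cvg_cst _) hv); exists d => // n /= dn.
rewrite lerBlDr.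
have -> : v - psum f z d = - (psum f z n - v) + (psum f z n - psum f z d) by ring.
apply: (le_trans (cmodD _ _)); rewrite cmodN lerD2l; exact: psum_diff.
Qed.

Lemma H2val_le f z v B : (forall k, cmod (f k) <= B) -> cmod z < 1 ->
  H2val f z v -> cmod v <= B / (1 - cmod z).
Proof.
move=> fB z1 /(H2val_tail 0 fB z1).
by rewrite /psum big_ord0 subr0 expr0 mul1r.
Qed.

Lemma H2val_lin f g z v w a : H2val f z v -> H2val g z w ->
  H2val (fun k => a * f k + g k) z (a * v + w).
Proof.
move=> hv hw; apply/H2valP.
apply: cvg0_le (cvg0D (cvg0Z (cmod a) hv) hw) => n; rewrite cmod_ge0 /=.
rewrite psumD psumZ.
have -> : a * psum f z n + psum g z n - (a * v + w) =
  a * (psum f z n - v) + (psum g z n - w) by ring.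
by apply: (le_trans (cmodD _ _)); rewrite cmodM.
Qed.

Lemma H2val_zero z : H2val (fun=> 0 : R[i]) z 0.
Proof.
apply/H2valP; have -> : (fun n => cmod (psum (fun=> 0) z n - 0)) = fun=> 0.
  by apply/funext => n; rewrite /psum subr0 big1 ?cmod0 // => i _; rewrite mul0r.
exact: cvg_cst.
Qed.

Lemma H2val_sum n (c : nat -> R[i]) (F : nat -> nat -> R[i]) z (V : nat -> R[i]) :
  (forall i, H2val (F i) z (V i)) ->
  H2val (fun k => \sum_(i < n) c i * F i k) z (\sum_(i < n) c i * V i).
Proof.
move=> hF; elim: n => [|n IH].
  by rewrite big_ord0; under eq_fun do rewrite big_ord0; exact: H2val_zero.
rewrite big_ord_recr /= addrC; under eq_fun do rewrite big_ord_recr /= addrC.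
exact: (H2val_lin (c n) (hF n) IH).
Qed.

(** Once the lower coefficients vanish, at a small real point [t] the term [f k * t ^+ k] is bounded
    by the tail from [k.+1] on, which is of order [t ^+ k.+1]; divide by [t ^+ k]. *)
Lemma identity_principle f B : (forall k, cmod (f k) <= B) ->
  (forall z, inD z -> H2val f z 0) -> forall k, f k = 0.
Proof.
move=> fB f0 k; elim/ltn_ind: k => k IH.
have B0 : 0 <= B by exact: le_trans (cmod_ge0 _) (fB 0).
apply/cmod_eq0/le_anti; rewrite cmod_ge0 andbT.
apply/ler_addgt0Pr => e e0; rewrite add0r.
(* The first bound gives [(1 - t)^-1 <= 2], and the second then gives [B * (t / (1 - t)) <= e]. *)
pose t : R := Num.min (2^-1) (e / (2 * (B + 1))).
have e1 : 0 < e / (2 * (B + 1)) by apply: divr_gt0 => //; lra.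
have t0 : 0 < t by rewrite lt_min e1 invr_gt0 ltr0n.
have t2 : t <= 2^-1 by rewrite ge_min lexx.
have te : t <= e / (2 * (B + 1)) by rewrite ge_min lexx orbT.
have ct : cmod (t%:C%C) = t by rewrite cmod_real ger0_norm // ltW.
have tD : cmod (t%:C%C) < 1 by rewrite ct; lra.
have := H2val_tail k.+1 fB tD (f0 _ tD).
rewrite sub0r cmodN /psum big_ord_recr /= big1 => [|i _]; last by rewrite IH // mul0r.
have -> : B * (cmod (t%:C%C) ^+ k.+1 / (1 - cmod (t%:C%C))) = B * (t / (1 - t)) * t ^+ k.
  by rewrite ct exprS -!mulrA; congr (_ * (_ * _)); rewrite mulrC.
rewrite add0r cmodM cmodX ct ler_pM2r ?exprn_gt0 //.
move=> h; apply: (le_trans h).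
have t3 : (1 - t)^-1 <= 2.
  by rewrite -[2]invrK lef_pV2 ?posrE ?invr_gt0; lra.
have te' : t * (2 * (B + 1)) <= e by rewrite -ler_pdivlMr //; lra.
have i0 : 0 <= (1 - t)^-1 by rewrite invr_ge0; lra.
nra.
Qed.

Lemma sqpart_coef f (M : R) k : (forall N, sqpart f N <= M) -> cmod (f k) ^+ 2 <= M.
Proof.
move=> /(_ k.+1); rewrite /sqpart big_ord_recr /=; apply: le_trans.
by rewrite lerDr sumr_ge0 // => i _; exact: sqr_ge0.
Qed.

Lemma cmod_le_sqrt z (M : R) : 0 <= M -> cmod z ^+ 2 <= M ^+ 2 -> cmod z <= M.
Proof. by move=> M0; rewrite ler_pXn2r ?nnegrE ?cmod_ge0. Qed.

Lemma sqpart_coef_le f (s : R) : 0 <= s -> (forall N, sqpart f N <= s ^+ 2) ->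
  forall k, cmod (f k) <= s.
Proof. by move=> s0 fs k; apply: cmod_le_sqrt => //; exact: sqpart_coef. Qed.

Lemma sqpart_has_sup f : inH2 f -> has_sup (range (sqpart f)).
Proof.
move=> [M fM]; split; first by exists (sqpart f 0), 0.
by exists M => _ [N _ <-].
Qed.

Lemma sqpart_le_norm f N : inH2 f -> sqpart f N <= H2norm f ^+ 2.
Proof.
move=> hf; have h : sqpart f N <= sup (range (sqpart f)).
  by apply: ub_le_sup; [have [] := sqpart_has_sup hf|exists N].
rewrite sqr_sqrtr //; apply: le_trans h.
by apply: sumr_ge0 => i _; exact: sqr_ge0.
Qed.

Lemma H2norm_ge0 f : 0 <= H2norm f. Proof. exact: sqrtr_ge0. Qed.

Lemma H2norm_le f (s : R) : 0 <= s -> (forall N, sqpart f N <= s ^+ 2) ->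
  H2norm f <= s.
Proof.
move=> s0 fs; rewrite /H2norm -[leRHS]ger0_norm // -sqrtr_sqr; apply: ler_wsqrtr.
apply: sup_le_ub; first by exists (sqpart f 0), 0.
by move=> _ [N _ <-].
Qed.

Lemma inH2_coef f : inH2 f -> forall k, cmod (f k) <= H2norm f.
Proof.
move=> hf; apply: sqpart_coef_le; first exact: H2norm_ge0.
by move=> N; exact: sqpart_le_norm.
Qed.

End PowerSeries.

(** * Ultrafilter limits of complex sequences and of coefficients *)

Section ComplexUltraLimit.
Variable R : realType.
Implicit Types (x y : nat -> R[i]).

Definition cseq_bounded x := exists M : R, forall n, cmod (x n) <= M.
Definition culim x : R[i] :=
  Complex (ulim (fun n => cre (x n))) (ulim (fun n => cim (x n))).

Lemma cseq_bounded_re x : cseq_bounded x -> seq_bounded (fun n => cre (x n)).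
Proof. by move=> [M h]; exists M => n; apply: le_trans (cre_le _) (h n). Qed.
Lemma cseq_bounded_im x : cseq_bounded x -> seq_bounded (fun n => cim (x n)).
Proof. by move=> [M h]; exists M => n; apply: le_trans (cim_le _) (h n). Qed.
Hint Resolve cseq_bounded_re cseq_bounded_im : core.

Lemma cseq_boundedD x y : cseq_bounded x -> cseq_bounded y ->
  cseq_bounded (fun n => x n + y n).
Proof.
move=> [M xM] [N yN]; exists (M + N) => n.
by rewrite (le_trans (cmodD _ _)) ?lerD.
Qed.
Lemma cseq_boundedZ a x : cseq_bounded x -> cseq_bounded (fun n => a * x n).
Proof.
move=> [M xM]; exists (cmod a * M) => n.
by rewrite cmodM ler_wpM2l // cmod_ge0.
Qed.
Lemma cseq_bounded_cst a : cseq_bounded (fun=> a).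
Proof. by exists (cmod a). Qed.

Lemma culimD x y : cseq_bounded x -> cseq_bounded y ->
  culim (fun n => x n + y n) = culim x + culim y.
Proof.
move=> bx byy; rewrite /culim; under eq_fun do rewrite creD.
by under [fun n => cim _]eq_fun do rewrite cimD; rewrite !ulimD; auto.
Qed.

Lemma culim_cst a : culim (fun=> a) = a.
Proof. by rewrite /culim !ulim_cst; case: a. Qed.

Lemma culimZ a x : cseq_bounded x -> culim (fun n => a * x n) = a * culim x.
Proof.
move=> bx; rewrite /culim; under eq_fun do rewrite creM.
under [fun n => cim _]eq_fun do rewrite cimM.
have -> : (fun n => cre a * cre (x n) - cim a * cim (x n)) =
          (fun n => cre a * cre (x n) + (- cim a) * cim (x n)).
  by apply/funext => n; ring.
rewrite !ulimD ?ulimZ; auto; try by apply: seq_boundedZ; auto.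
by case: a => a b /=; congr Complex; ring.
Qed.

Lemma ulimM (u v : nat -> R) : seq_bounded u -> seq_bounded v ->
  ulim (fun n => u n * v n) = ulim u * ulim v.
Proof. by move=> /ulimP bu /ulimP bv; apply: ulim_cvg; apply: cvgM. Qed.

Lemma seq_boundedM (u v : nat -> R) : seq_bounded u -> seq_bounded v ->
  seq_bounded (fun n => u n * v n).
Proof.
move=> [M uM] [N vN]; exists (M * N) => n.
by rewrite normrM; apply: ler_pM.
Qed.

Lemma culim_sq x : cseq_bounded x ->
  ulim (fun n => cmod (x n) ^+ 2) = cmod (culim x) ^+ 2.
Proof.
move=> bx; rewrite cmod_sq /=.
under eq_fun do rewrite cmod_sq !expr2.
by rewrite ulimD ?ulimM; auto; apply: seq_boundedM; auto.
Qed.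

(** A Fatou-type statement: only [K] coordinates enter, so the limit commutes with the partial sum,
    and norm bounds survive coefficientwise limits. *)
Lemma culim_sqpart (X : nat -> nat -> R[i]) (c : nat -> R) (l : R) K :
  (forall i, cseq_bounded (fun n => X n i)) -> c @ \oo --> l ->
  (\forall n \near \oo, sqpart (X n) K <= c n) ->
  sqpart (fun i => culim (fun n => X n i)) K <= l.
Proof.
move=> bX cl Xc.
have bsq i : seq_bounded (fun n => cmod (X n i) ^+ 2).
  have [M h] := bX i; exists (M ^+ 2) => n; rewrite ger0_norm ?sqr_ge0 //.
  by apply: lerXn2r; rewrite ?nnegrE ?cmod_ge0 //; exact: le_trans (cmod_ge0 _) (h n).
have [bs e] : seq_bounded (fun n => sqpart (X n) K) /\
   ulim (fun n => sqpart (X n) K) = sqpart (fun i => culim (fun n => X n i)) K.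
  rewrite /sqpart; elim: K {Xc} => [|K [IHb IHe]].
    under eq_fun do rewrite big_ord0.
    by rewrite big_ord0 ulim_cst; split => //; exact: seq_bounded_cst.
  under eq_fun do rewrite big_ord_recr /=.
  rewrite big_ord_recr /= ulimD // IHe culim_sq //; split => //.
  exact: seq_boundedD.
have cU : c @ free_ultrafilter --> l by move=> A /cl; apply: eventually_ultra.
by rewrite -e; apply: (ler_cvg_to (ulimP bs) cU); apply: eventually_ultra.
Qed.

Lemma culim_le x (c : R) : cseq_bounded x -> 0 <= c ->
  (\forall n \near \oo, cmod (x n) <= c) -> cmod (culim x) <= c.
Proof.
move=> bx c0 xc.
apply: cmod_le_sqrt => //; rewrite -culim_sq // -[leRHS]ulim_cst; apply: ulim_le.
- have [M h] := bx; exists (M ^+ 2) => n; rewrite ger0_norm ?sqr_ge0 //.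
  by apply: lerXn2r; rewrite ?nnegrE ?cmod_ge0 //; exact: le_trans (cmod_ge0 _) (h n).
- exact: seq_bounded_cst.
by apply: filterS xc => n xn; apply: lerXn2r; rewrite ?nnegrE ?cmod_ge0.
Qed.

Lemma culim_cvg x a : (fun n => cmod (x n - a)) @ \oo --> (0 : R) -> culim x = a.
Proof.
move=> h; case: a h => a b h; rewrite /culim; congr Complex; apply: ulim_oo;
  apply/cvgrPdist_le => e e0.
  by move/cvgrPdist_le: h => /(_ _ e0); apply: filterS => n /=; rewrite sub0r normrN
    (ger0_norm (cmod_ge0 _)); apply: le_trans; rewrite distrC;
    apply: le_trans (cre_le _); rewrite creB.
by move/cvgrPdist_le: h => /(_ _ e0); apply: filterS => n /=; rewrite sub0r normrN
    (ger0_norm (cmod_ge0 _)); apply: le_trans; rewrite distrC;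
    apply: le_trans (cim_le _); rewrite cimB.
Qed.

Lemma culim_sum (X : nat -> nat -> R[i]) d :
  (forall i, cseq_bounded (X i)) ->
  cseq_bounded (fun n => \sum_(i < d) X i n) /\
  culim (fun n => \sum_(i < d) X i n) = \sum_(i < d) culim (X i).
Proof.
move=> bX; elim: d => [|d [IHb IHe]].
  under eq_fun do rewrite big_ord0.
  by rewrite big_ord0 culim_cst; split => //; exact: cseq_bounded_cst.
under eq_fun do rewrite big_ord_recr /=.
rewrite big_ord_recr /= culimD // IHe; split => //.
exact: cseq_boundedD.
Qed.

(** The ultrafilter limit of the partial sums is the candidate; the geometric estimate of
    [psum_diff] upgrades it to a limit in the ordinary sense. *)
Lemma H2val_exists (f : nat -> R[i]) (z : R[i]) (B : R) :
  (forall k, cmod (f k) <= B) -> cmod z < 1 -> exists v, H2val f z v.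
Proof.
move=> fB z1; exists (culim (psum f z)); apply/H2valP.
have B0 : 0 <= B by exact: le_trans (cmod_ge0 _) (fB 0).
pose c := B / (1 - cmod z).
have bp : cseq_bounded (psum f z).
  exists c => n; have := psum_diff fB z1 (leq0n n).
  by rewrite /psum big_ord0 subr0 expr0 mul1r.
apply: (@cvg0_le _ _ (fun d => c * cmod z ^+ d)) => [d|]; last first.
  rewrite -[X in _ --> X](mulr0 c); apply: cvgMr; apply: cvg_expr.
  by rewrite ger0_norm ?cmod_ge0.
rewrite cmod_ge0 /= cmodB.
have -> : c * cmod z ^+ d = B * (cmod z ^+ d / (1 - cmod z)).
  by rewrite /c mulrAC mulrA.
have -> : culim (psum f z) - psum f z d =
          culim (fun n => psum f z n + (- psum f z d)).
  by rewrite culimD ?culim_cst //; exact: cseq_bounded_cst.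
apply: culim_le.
- by apply: cseq_boundedD => //; exact: cseq_bounded_cst.
- by rewrite mulr_ge0 // divr_ge0 ?exprn_ge0 ?cmod_ge0 // subr_ge0 ltW.
by exists d => // n dn; exact: psum_diff.
Qed.

End ComplexUltraLimit.

(** * Operators with rapidly decreasing monomial images *)

Section CauchySchwarz.
Variable R : realType.

(** In the induction the cross term [2 * S * (x i * y i)] is controlled by [S ^+ 2 <= A * B] and the
    arithmetic-geometric mean inequality. *)
Lemma cauchy_schwarz (I : Type) (s : seq I) (x y : I -> R) :
  (\sum_(i <- s) x i * y i) ^+ 2 <= (\sum_(i <- s) x i ^+ 2) * \sum_(i <- s) y i ^+ 2.
Proof.
elim: s => [|i s IH]; first by rewrite !big_nil expr0n mul0r.
rewrite !big_cons.
set A := \sum_(j <- s) x j ^+ 2 in IH *; set B := \sum_(j <- s) y j ^+ 2 in IH *.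
set S := \sum_(j <- s) x j * y j in IH *.
have A0 : 0 <= A by apply: sumr_ge0 => j _; exact: sqr_ge0.
have B0 : 0 <= B by apply: sumr_ge0 => j _; exact: sqr_ge0.
have T0 : 0 <= A * y i ^+ 2 + B * x i ^+ 2 by rewrite addr_ge0 // mulr_ge0 ?sqr_ge0.
have h : `|2 * S * (x i * y i)| <= A * y i ^+ 2 + B * x i ^+ 2.
  rewrite -(@ler_pXn2r _ 2) ?nnegrE // real_normK ?num_real //.
  apply: (@le_trans _ _ (4 * (A * B) * (x i * y i) ^+ 2)).
    rewrite (_ : (2 * S * (x i * y i)) ^+ 2 = 4 * S ^+ 2 * (x i * y i) ^+ 2); last by ring.
    by apply: ler_wpM2r; rewrite ?sqr_ge0 // ler_wpM2l.
  by have := sqr_ge0 (A * y i ^+ 2 - B * x i ^+ 2); nra.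
move: h; rewrite ler_norml => /andP[_ h]; nra.
Qed.

Lemma cauchy_schwarz_cmod (I : Type) (s : seq I) (x y : I -> R[i]) :
  cmod (\sum_(i <- s) x i * y i) ^+ 2 <=
  (\sum_(i <- s) cmod (x i) ^+ 2) * \sum_(i <- s) cmod (y i) ^+ 2.
Proof.
apply: le_trans (cauchy_schwarz _ _ _).
apply: lerXn2r; rewrite ?nnegrE ?cmod_ge0 //.
  by apply: sumr_ge0 => i _; rewrite mulr_ge0 ?cmod_ge0.
apply: (le_trans (cmod_sum _ _ _)); apply: ler_sum => i _; by rewrite cmodM.
Qed.

(** The induction runs on the sharper bound [2 - L.+1%:R^-1], which absorbs the next term. *)
Lemma sum_inv_sq (L : nat) : \sum_(k < L) (k.+1%:R ^+ 2)^-1 <= 2 :> R.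
Proof.
case: L => [|L]; first by rewrite big_ord0.
suff h : \sum_(k < L.+1) (k.+1%:R ^+ 2)^-1 <= 2 - L.+1%:R^-1 :> R.
  by apply: (le_trans h); rewrite gerBl invr_ge0.
elim: L => [|L IH]; first by rewrite big_ord1 expr1n invr1; lra.
rewrite big_ord_recr /=; apply: (le_trans (lerD IH (lexx _))).
set a : R := L.+1%:R; have a0 : 0 < a by rewrite ltr0n.
have -> : L.+2%:R = a + 1 :> R by rewrite /a natr1.
have -> : 2 - a^-1 + ((a + 1) ^+ 2)^-1 =
   2 - (a + 1)^-1 - (a * (a + 1) ^+ 2)^-1.
  by field; apply/andP; split; rewrite gt_eqF //; lra.
by rewrite gerBl invr_ge0 mulr_ge0 ?sqr_ge0 // ltW.
Qed.

End CauchySchwarz.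

(** * The weighted composition operator and its approximation numbers *)

Section RapidDecay.
Variable R : realType.
Variables (phi wv : R[i] -> R[i]) (h : nat -> nat -> R[i]).
Hypothesis phiD : forall z, inD z -> inD (phi z).
Hypothesis hval : forall n z, inD z -> H2val (h n) z (wv z * phi z ^+ n).
Hypothesis hdecay : forall q : nat, exists C : R, 0 <= C /\
  forall n K, sqpart (h n) K <= C / n.+1%:R ^+ q.

(** From the decay of order [q + q + 2], two powers make the tail summable and [q + q] are left
    over. The bound is a square since it will bound a squared operator norm. *)
Lemma tail_decay q : exists C : R, 0 <= C /\
  forall n L K, (n <= L)%N ->
  \sum_(n <= k < L) sqpart (h k) K <= (C / n.+1%:R ^+ q) ^+ 2.
Proof.
have [C [C0 hC]] := hdecay (q + q + 2).
exists (Num.sqrt (2 * C)); split=> [|n L K nL]; first exact: sqrtr_ge0.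
have n0 : 0 < n.+1%:R :> R by rewrite ltr0n.
rewrite exprMn sqr_sqrtr ?mulr_ge0 // exprVn -exprM muln2 -addnn.
apply: (@le_trans _ _ (\sum_(n <= k < L) C / n.+1%:R ^+ (q + q) * (k.+1%:R ^+ 2)^-1)).
  rewrite big_nat_cond [leRHS]big_nat_cond; apply: ler_sum => k /andP[/andP[nk _] _].
  have k0 : 0 < k.+1%:R :> R by rewrite ltr0n.
  apply: (le_trans (hC _ _)); rewrite exprD invfM mulrA.
  apply: ler_wpM2r; first by rewrite invr_ge0 exprn_ge0.
  apply: ler_wpM2l => //; rewrite lef_pV2 ?posrE ?exprn_gt0 //.
  by apply: lerXn2r; rewrite ?nnegrE ?ler0n // ler_nat.
rewrite -mulr_sumr.
have -> : 2 * C * (n.+1%:R ^+ (q + q))^-1 = C / n.+1%:R ^+ (q + q) * 2 :> R.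
  by rewrite -mulrA mulrC.
apply: ler_wpM2l; first by rewrite divr_ge0 ?exprn_ge0.
apply: le_trans (sum_inv_sq R L); rewrite -(big_mkord xpredT (fun k => (k.+1%:R ^+ 2)^-1)).
rewrite [leRHS](big_cat_nat (leq0n n) nL) /= lerDr.
by apply: sumr_ge0 => k _; rewrite invr_ge0 sqr_ge0.
Qed.

(** As [h k] represents [wv * phi ^ k], these are the coefficients of [wv] times the [n]-th partial
    sum of [f] composed with [phi]. *)
Definition trunc_op (n : nat) (f : nat -> R[i]) : nat -> R[i] :=
  fun i => \sum_(k < n) f k * h k i.

Definition full_op (f : nat -> R[i]) : nat -> R[i] :=
  fun i => culim (fun n => trunc_op n f i).

(** Cauchy-Schwarz in [k] for each coefficient index [i], then summation over [i]. *)
Lemma trunc_op_diff f n L K (t : R) : inH2 f -> (n <= L)%N ->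
  \sum_(n <= k < L) sqpart (h k) K <= t ->
  sqpart (fun i => trunc_op L f i - trunc_op n f i) K <= H2norm f ^+ 2 * t.
Proof.
move=> hf nL ht.
apply: (@le_trans _ _ (H2norm f ^+ 2 * \sum_(n <= k < L) sqpart (h k) K)); last first.
  by apply: ler_wpM2l => //; exact: sqr_ge0.
rewrite exchange_big /= mulr_sumr; apply: ler_sum => i _.
rewrite /trunc_op -!(big_mkord xpredT (fun k => f k * h k i)).
rewrite (big_cat_nat (leq0n n) nL) /= addrAC subrr add0r.
apply: (le_trans (cauchy_schwarz_cmod _ _ _)); apply: ler_wpM2r.
  by apply: sumr_ge0 => k _; exact: sqr_ge0.
apply: le_trans (sqpart_le_norm L hf).
rewrite /sqpart -(big_mkord xpredT (fun k => cmod (f k) ^+ 2)).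
by rewrite [leRHS](big_cat_nat (leq0n n) nL) /= lerDr sumr_ge0 // => k _; exact: sqr_ge0.
Qed.

Lemma trunc_op0 f : trunc_op 0 f = fun=> 0.
Proof. by apply/funext => i; rewrite /trunc_op big_ord0. Qed.

Section Decay.
Variables (q : nat) (C : R).
Hypothesis C0 : 0 <= C.
Hypothesis hC : forall n L K, (n <= L)%N ->
  \sum_(n <= k < L) sqpart (h k) K <= (C / n.+1%:R ^+ q) ^+ 2.

Let s n : R := C / n.+1%:R ^+ q.
Let s_ge0 n : 0 <= s n. Proof. by rewrite divr_ge0 ?exprn_ge0. Qed.

Lemma trunc_op_sqpart f n K : inH2 f ->
  sqpart (trunc_op n f) K <= (s 0 * H2norm f) ^+ 2.
Proof.
move=> hf; have := trunc_op_diff hf (leq0n n) (hC K (leq0n n)).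
rewrite trunc_op0 -exprMn mulrC; under eq_fun do rewrite subr0.
by [].
Qed.

Lemma trunc_op_bounded f i : inH2 f -> cseq_bounded (fun n => trunc_op n f i).
Proof.
move=> hf; exists (s 0 * H2norm f) => n.
apply: (@sqpart_coef_le _ (trunc_op n f)); first by rewrite mulr_ge0 // H2norm_ge0.
by move=> N; exact: trunc_op_sqpart.
Qed.

Lemma full_op_sqpart f n K : inH2 f ->
  sqpart (fun i => full_op f i - trunc_op n f i) K <= (s n * H2norm f) ^+ 2.
Proof.
move=> hf.
have -> : (fun i => full_op f i - trunc_op n f i) =
    (fun i => culim (fun L => trunc_op L f i + - trunc_op n f i)).
  apply/funext => i; rewrite culimD ?culim_cst //; first exact: trunc_op_bounded.
  exact: cseq_bounded_cst.
apply: (@culim_sqpart _ (fun L i => trunc_op L f i + - trunc_op n f i) (fun=> _)).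
- move=> i; apply: cseq_boundedD; [exact: trunc_op_bounded|exact: cseq_bounded_cst].
- exact: cvg_cst.
exists n => // L nL; rewrite exprMn mulrC.
exact: trunc_op_diff (hC K nL).
Qed.

Lemma full_op_sqpart0 f K : inH2 f ->
  sqpart (full_op f) K <= (s 0 * H2norm f) ^+ 2.
Proof.
move=> hf; have := full_op_sqpart 0 K hf; rewrite trunc_op0.
by under eq_fun do rewrite subr0.
Qed.

Lemma finrank_trunc_op n : finrank_op n (trunc_op n).
Proof.
split=> [f g a hf hg|].
  apply/funext => i; rewrite /trunc_op mulr_sumr -big_split; apply: eq_bigr => k _ /=.
  by rewrite mulrDl mulrA.
split.
  exists (s 0) => f hf; split.
    by exists ((s 0 * H2norm f) ^+ 2) => N; exact: trunc_op_sqpart.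
  apply: H2norm_le; first by rewrite mulr_ge0 // H2norm_ge0.
  by move=> N; exact: trunc_op_sqpart.
exists (fun i => h i); split.
  move=> i; have [D [D0 hD]] := hdecay 0; exists D => N.
  by apply: (le_trans (hD _ _)); rewrite expr0 invr1 mulr1.
by move=> f hf; exists (fun i => f i).
Qed.

End Decay.

(** Compare both sides with the value of [trunc_op n f] at [z]. The two errors are the operator
    tail, of order [n.+1%:R^-1], and the error of the partial sum of [f] at [phi z]; both tend to
    0. *)
Lemma full_op_val f z fv : inH2 f -> inD z -> H2val f (phi z) fv ->
  H2val (full_op f) z (wv z * fv).
Proof.
move=> hf zD hfv; have [C [C0 hC]] := tail_decay 1.
have s_ge0 n : 0 <= C / n.+1%:R ^+ 1 * H2norm f.
  by rewrite mulr_ge0 ?H2norm_ge0 // divr_ge0 ?exprn_ge0.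
have z1 : 0 < 1 - cmod z by rewrite subr_gt0.
have [y hy] : exists y, H2val (full_op f) z y.
  apply: (@H2val_exists _ _ _ (C / 1%:R ^+ 1 * H2norm f)) => //.
  by apply: sqpart_coef_le => // N; exact: (full_op_sqpart0 C0 hC).
suff -> : wv z * fv = y by [].
apply/eqP; rewrite eq_sym -subr_eq0; apply/eqP/cmod_eq0/le_anti; rewrite cmod_ge0 andbT.
pose u n : R := C * H2norm f / (1 - cmod z) * n.+1%:R^-1 +
   cmod (wv z) * cmod (psum f (phi z) n - fv).
apply: (@le_of_cvg0 _ _ u) => [|n].
  apply: cvg0D; first by apply: cvg0Z; exact: cvg_harmonic.
  exact: cvg0Z hfv.
have ht : H2val (trunc_op n f) z (wv z * psum f (phi z) n).
  have := @H2val_sum _ n f h z (fun k => wv z * phi z ^+ k) (fun k => hval k zD).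
  rewrite /psum mulr_sumr; under eq_bigr do rewrite mulrCA.
  by [].
have hd := H2val_lin (-1) ht hy.
have hB k : cmod (-1 * trunc_op n f k + full_op f k) <= C / n.+1%:R ^+ 1 * H2norm f.
  apply: (@sqpart_coef_le _ (fun k => -1 * trunc_op n f k + full_op f k)) => // N.
  under eq_fun do rewrite mulN1r addrC; exact: full_op_sqpart.
have := H2val_le hB zD hd.
have -> : y - wv z * fv = (-1 * (wv z * psum f (phi z) n) + y) +
    wv z * (psum f (phi z) n - fv) by ring.
move=> hle; apply: (le_trans (cmodD _ _)); rewrite cmodM /u lerD2r.
by apply: (le_trans hle); rewrite expr1 (mulrAC C) (mulrAC _ _ (1 - cmod z)^-1).
Qed.

Lemma wcomp_full_op f : inH2 f -> wcomp (h 0) phi f (full_op f).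
Proof.
move=> hf; have [C [C0 hC]] := tail_decay 0; split.
  by exists ((C / 1%:R ^+ 0 * H2norm f) ^+ 2) => N; exact: full_op_sqpart0.
move=> z zD; have [fv hfv] := H2val_exists (inH2_coef hf) (phiD zD).
exists fv, (wv z); split => //; split; last exact: full_op_val.
by have := hval 0 zD; rewrite expr0 mulr1.
Qed.

(** Equal values on the disk force equal coefficients. Since [approx_num] ranges over every [g]
    related to [f], this lets it be estimated on [full_op] alone. *)
Lemma wcomp_uniq f g : inH2 f -> wcomp (h 0) phi f g -> g = full_op f.
Proof.
move=> hf [hg gv]; have [hT Tv] := wcomp_full_op hf.
apply/funext => k; apply/eqP; rewrite -subr_eq0 -mulN1r addrC; apply/eqP.
apply: (@identity_principle _ (fun k => -1 * full_op f k + g k)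
  (H2norm (full_op f) + H2norm g)) => [j|z zD].
  apply: (le_trans (cmodD _ _)); rewrite mulN1r cmodN; apply: lerD; exact: inH2_coef.
have [fv [w [hfv [hw hgv]]]] := gv z zD.
have [fv' [w' [hfv' [hw' hgv']]]] := Tv z zD.
rewrite (H2val_uniq hfv' hfv) (H2val_uniq hw' hw) in hgv'.
by have := H2val_lin (-1) hgv' hgv; rewrite mulN1r addNr.
Qed.

Lemma bounded_wcomp : bounded_op (wcomp (h 0) phi).
Proof.
have [C [C0 hC]] := tail_decay 0; exists (C / 1%:R ^+ 0) => f hf.
exists (full_op f); split; first exact: wcomp_full_op.
apply: H2norm_le; first by rewrite mulr_ge0 ?H2norm_ge0 // divr_ge0 ?exprn_ge0.
by move=> N; exact: full_op_sqpart0.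
Qed.

(** [trunc_op n] has rank at most [n] and its distance to the operator is governed by
    [tail_decay q], so this distance belongs to the set whose infimum is taken. *)
Lemma approx_num_decay q : exists C : R, 0 <= C /\
  forall n, 0 <= approx_num (wcomp (h 0) phi) n <= C / n.+1%:R ^+ q.
Proof.
have [C [C0 hC]] := tail_decay q; exists C; split => // n.
have sn : 0 <= C / n.+1%:R ^+ q by rewrite divr_ge0 ?exprn_ge0.
rewrite /approx_num; set A := [set s | _].
have As : A (C / n.+1%:R ^+ q).
  split => //; exists (trunc_op n); split; first exact: (finrank_trunc_op C0 hC).
  move=> f g hf /(wcomp_uniq hf) ->.
  apply: H2norm_le; first by rewrite mulr_ge0 // H2norm_ge0.
  by move=> N; exact: full_op_sqpart.
apply/andP; split; last by apply: ge_inf => //; exists 0 => x [].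
by apply: lb_le_inf; [exists (C / n.+1%:R ^+ q)|move=> x []].
Qed.

Lemma schatten_wcomp (p : R) : 0 < p -> schatten p (wcomp (h 0) phi).
Proof.
move=> p0; split; first exact: bounded_wcomp.
(* This [q] satisfies [q * p >= 2], so the [p]-th powers of the approximation numbers are dominated
   by inverse squares. *)
pose q := (Num.truncn (2 / p)).+1.
have qp : 2 <= q%:R * p.
  by rewrite -ler_pdivrMr // ltW // truncnS_gt.
have [C [C0 hC]] := approx_num_decay q.
exists (powR C p * 2) => N.
apply: (@le_trans _ _ (\sum_(n < N) powR C p * (n.+1%:R ^+ 2)^-1)); last first.
  by rewrite -mulr_sumr ler_wpM2l ?powR_ge0 ?sum_inv_sq.
apply: ler_sum => n _; have /andP[a0 aC] := hC n.
have n1 : 1 <= n.+1%:R :> R by rewrite ler1n.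
have n0 : 0 <= n.+1%:R :> R by lra.
apply: (@le_trans _ _ (powR (C / n.+1%:R ^+ q) p)).
  by apply: ge0_ler_powR; rewrite ?nnegrE ?(le_trans a0 aC) ?(ltW p0).
rewrite powRM ?invr_ge0 ?exprn_ge0 //; apply: ler_wpM2l; first exact: powR_ge0.
rewrite -powR_inv1 ?exprn_ge0 // -powRrM mulN1r powRN lef_pV2 ?posrE; last 2 first.
- by rewrite powR_gt0 // exprn_gt0 //; lra.
- by rewrite exprn_gt0 //; lra.
rewrite -(powR_mulrn q) // -powRrM -(powR_mulrn 2) //; exact: ler_powR.
Qed.

End RapidDecay.

(** * Ratios of weights *)

Section WeightRatio.
Variable R : realType.
Implicit Types (eta x t : R) (N : nat).

(** The weight [W_N] at one point, with [x] standing for [|w0|^2] and [t] for [|phi|^2], so that the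
    key inequality is about real numbers only. *)
Definition wsum eta x t N : R := eta + x * \sum_(n < N.+1) t ^+ n.

Lemma wsum_ge eta x t N : 0 <= x -> 0 <= t -> eta <= wsum eta x t N.
Proof.
by move=> x0 t0; rewrite lerDl mulr_ge0 // sumr_ge0 // => i _; exact: exprn_ge0.
Qed.

Lemma wsum_mono eta x t N1 N2 : 0 <= x -> 0 <= t -> (N1 <= N2)%N ->
  wsum eta x t N1 <= wsum eta x t N2.
Proof.
move=> x0 t0 le12; rewrite lerD2l ler_wpM2l // -!(big_mkord xpredT (fun n => t ^+ n)).
rewrite [leRHS](big_cat_nat (leq0n _) (ltac:(by rewrite ltnS) : (N1.+1 <= N2.+1)%N)) /=.
by rewrite lerDl sumr_ge0 // => i _; exact: exprn_ge0.
Qed.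

Lemma wsum_lower eta x t N n : 0 <= eta -> 0 <= x -> 0 <= t <= 1 -> (n <= N)%N ->
  x * (n.+1%:R * t ^+ n) <= wsum eta x t N.
Proof.
move=> e0 x0 /andP[t0 t1] nN; apply: le_trans (wsum_mono eta x0 t0 nN).
rewrite /wsum; apply: ler_wpDl => //; apply: ler_wpM2l => //.
have -> : n.+1%:R * t ^+ n = \sum_(i < n.+1) t ^+ n.
  by rewrite sumr_const card_ord mulr_natl.
apply: ler_sum => i _; apply: ler_wiXn2l => //; by rewrite -ltnS.
Qed.

Lemma wsum_upper eta x t N : 0 <= x -> 0 <= t <= 1 -> eta <= x ->
  wsum eta x t N <= x * (2 * N.+1%:R).
Proof.
move=> x0 /andP[t0 t1] ex.
have h : \sum_(n < N.+1) t ^+ n <= N.+1%:R.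
  have -> : N.+1%:R = \sum_(n < N.+1) (1 : R) by rewrite sumr_const card_ord.
  by apply: ler_sum => i _; exact: exprn_ile1.
have hN : 1 <= N.+1%:R :> R by rewrite ler1n.
rewrite /wsum; nra.
Qed.

(** Since [M >= n * j], the power [t ^+ M] gives one [t ^+ n] to each of the first [j] factors, and
    [wsum_upper] with [wsum_lower] bounds each such pair by [2 * (Ns i).+1%:R / n.+1%:R]. The
    remaining factors are at most 1. *)
Lemma prod_wsum_ratio (Ns : nat -> nat) I j n M eta x t :
  0 < eta -> 0 <= x -> 0 <= t <= 1 -> {homo Ns : a b / (a <= b)%N} ->
  (j <= I)%N -> (n <= Ns I)%N -> (n * j <= M)%N ->
  x * t ^+ M * \prod_(i < I) (wsum eta x t (Ns i) / wsum eta x t (Ns I)) <=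
  (\prod_(i < j) (2 * (Ns i).+1%:R)) * x / n.+1%:R ^+ j + eta.
Proof.
move=> e0 x0 t01 Nmono jI nI njM; have /andP[t0 t1] := t01.
have W0 N : 0 < wsum eta x t N by apply: lt_le_trans e0 (wsum_ge _ _ _ _).
have r01 i : 0 <= wsum eta x t (Ns i) / wsum eta x t (Ns I).
  by rewrite divr_ge0 // ltW.
have r1 i : (i <= I)%N -> wsum eta x t (Ns i) / wsum eta x t (Ns I) <= 1.
  by move=> iI; rewrite ler_pdivrMr // mul1r; apply: wsum_mono => //; exact: Nmono.
have tM0 : 0 <= t ^+ M by exact: exprn_ge0.
have tM1 : t ^+ M <= 1 by exact: exprn_ile1.
have P0 : 0 <= \prod_(i < I) (wsum eta x t (Ns i) / wsum eta x t (Ns I)).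
  by apply: prodr_ge0.
have K0 : 0 <= \prod_(i < j) (2 * (Ns i).+1%:R) :> R.
  by apply: prodr_ge0 => i _; rewrite mulr_ge0.
have n0 : 0 < n.+1%:R :> R by rewrite ltr0n.
(* Where [x] is below [eta], [wsum_upper] does not apply, but the left side is at most [x]; this
   case is what the summand [eta] pays for. *)
have [xe|ex] := ltP x eta.
  have P1 : \prod_(i < I) (wsum eta x t (Ns i) / wsum eta x t (Ns I)) <= 1.
    by apply: prodr_ile1 => i _; rewrite r01 r1 // ltnW.
  apply: (@le_trans _ _ (0 + eta)); last first.
    by rewrite lerD2r divr_ge0 ?mulr_ge0 ?exprn_ge0 // ltW.
  rewrite add0r; apply: (@le_trans _ _ (x * 1 * 1)); last by lra.
  by rewrite !mulr1 -[leRHS]mulr1 ler_pM ?mulr_ge0 // -[leRHS]mulr1 ler_wpM2l.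
apply: ler_wpDr; first exact: ltW.
rewrite -[leLHS]mulrA [X in _ <= X / _]mulrC -[leRHS]mulrA; apply: ler_wpM2l => //.
rewrite -(big_mkord xpredT (fun i => wsum eta x t (Ns i) / wsum eta x t (Ns I))).
rewrite (big_cat_nat (leq0n j) jI) /=.
have P2 : \prod_(j <= i < I) (wsum eta x t (Ns i) / wsum eta x t (Ns I)) <= 1.
  rewrite big_nat_cond; apply: prodr_ile1 => i; rewrite andbT => /andP[_ iI].
  by rewrite r01 r1 // ltnW.
have P3 : 0 <= \prod_(0 <= i < j) (wsum eta x t (Ns i) / wsum eta x t (Ns I)).
  exact: prodr_ge0.
apply: (@le_trans _ _ (t ^+ M * \prod_(0 <= i < j) (wsum eta x t (Ns i) / wsum eta x t (Ns I)))).
  by rewrite ler_wpM2l // -[leRHS]mulr1 ler_wpM2l.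
apply: (@le_trans _ _ (t ^+ (n * j) * \prod_(0 <= i < j) (wsum eta x t (Ns i) / wsum eta x t (Ns I)))).
  by apply: ler_wpM2r => //; apply: ler_wiXn2l.
rewrite exprM big_mkord.
have -> : (t ^+ n) ^+ j = \prod_(i < j) t ^+ n by rewrite prodr_const card_ord.
have -> : n.+1%:R ^+ j = \prod_(i < j) n.+1%:R :> R by rewrite prodr_const card_ord.
rewrite -prodf_div -big_split /=; apply: ler_prod => i _; rewrite mulr_ge0 ?exprn_ge0 //=.
rewrite mulrA ler_pdivrMr // mulrAC ler_pdivlMr //.
have h1 := wsum_upper (Ns i) x0 t01 ex.
have h2 := wsum_lower (ltW e0) x0 t01 nI.
have tn0 : 0 <= t ^+ n by exact: exprn_ge0.
apply: (@le_trans _ _ (t ^+ n * (x * (2 * (Ns i).+1%:R)) * n.+1%:R)).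
  by rewrite ler_pM2r // ler_wpM2l.
rewrite (_ : _ * _ * _ = 2 * (Ns i).+1%:R * (x * (n.+1%:R * t ^+ n))); last by ring.
by apply: ler_wpM2l; rewrite ?mulr_ge0.
Qed.

End WeightRatio.

(** * Values and coefficients of limits of polynomials *)

Section PolyLimits.
Variable R : realType.

Lemma culimM (x y : nat -> R[i]) : cseq_bounded x -> cseq_bounded y ->
  culim (fun n => x n * y n) = culim x * culim y.
Proof.
move=> bx byy; have bxr := cseq_bounded_re bx; have bxi := cseq_bounded_im bx.
have byr := cseq_bounded_re byy; have byi := cseq_bounded_im byy.
rewrite /culim; under eq_fun do rewrite creM -mulN1r.
under [fun n => cim _]eq_fun do rewrite cimM.
rewrite !ulimD ?ulimZ ?ulimM //; try (by apply: seq_boundedM);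
  try (by apply: seq_boundedZ; apply: seq_boundedM).
by apply/eqP; rewrite eq_complex /= mulN1r eqxx /= [X in _ + X]mulrC addrC [X in X + _]mulrC [X in _ + X]mulrC.
Qed.

Lemma horner_psum (Q : {poly R[i]}) z d : (size Q <= d)%N ->
  Q.[z] = psum (fun k => Q`_k) z d.
Proof. by move=> sQ; rewrite (horner_coef_wide _ sQ). Qed.

Lemma horner_tail (Q : {poly R[i]}) z (B : R) d : (forall k, cmod Q`_k <= B) ->
  cmod z < 1 ->
  cmod (Q.[z] - psum (fun k => Q`_k) z d) <= B * (cmod z ^+ d / (1 - cmod z)).
Proof.
move=> QB z1; rewrite (@horner_psum Q z (maxn (size Q) d)) ?leq_maxl //.
by apply: psum_diff => //; exact: leq_maxr.
Qed.

(** The tails of all [Q I] at [z] obey one geometric bound, so the limit in [I] may be exchanged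
    with the summation of the power series. *)
Lemma H2val_culim (Q : nat -> {poly R[i]}) (B : R) z :
  (forall I k, cmod (Q I)`_k <= B) -> cmod z < 1 ->
  cseq_bounded (fun I => (Q I).[z]) /\
  H2val (fun i => culim (fun I => (Q I)`_i)) z (culim (fun I => (Q I).[z])).
Proof.
move=> QB z1; have B0 : 0 <= B by exact: le_trans (cmod_ge0 _) (QB 0 0).
have bz : cseq_bounded (fun I => (Q I).[z]).
  exists (B / (1 - cmod z)) => I; have := horner_tail 0 (QB I) z1.
  by rewrite /psum big_ord0 subr0 expr0 mul1r.
split => //; apply/H2valP.
pose c := B / (1 - cmod z).
apply: (@cvg0_le _ _ (fun d => c * cmod z ^+ d)) => [d|]; last first.
  by apply: cvg0Z; apply: cvg_expr; rewrite ger0_norm ?cmod_ge0.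
rewrite cmod_ge0 /= cmodB.
have -> : c * cmod z ^+ d = B * (cmod z ^+ d / (1 - cmod z)).
  by rewrite /c mulrAC mulrA.
have bc i : cseq_bounded (fun I => (Q I)`_i * z ^+ i).
  by exists (B * cmod (z ^+ i)) => I; rewrite cmodM ler_wpM2r ?cmod_ge0.
have [bs es] := culim_sum d bc.
have -> : psum (fun i => culim (fun I => (Q I)`_i)) z d =
          culim (fun I => psum (fun k => (Q I)`_k) z d).
  rewrite es; apply: eq_bigr => i _; rewrite [RHS]culimM.
  - by rewrite culim_cst.
  - by exists B => I.
  - exact: cseq_bounded_cst.
have bs' : cseq_bounded (fun I => -1 * psum (fun k => (Q I)`_k) z d).
  exact: cseq_boundedZ.
have -> : culim (fun I => (Q I).[z]) - culim (fun I => psum (fun k => (Q I)`_k) z d) =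
   culim (fun I => (Q I).[z] + -1 * psum (fun k => (Q I)`_k) z d).
  by rewrite culimD // culimZ // mulN1r.
apply: culim_le.
- exact: cseq_boundedD.
- by rewrite mulr_ge0 // divr_ge0 ?exprn_ge0 ?cmod_ge0 // subr_ge0 ltW.
by apply: nearW => I; rewrite mulN1r; exact: horner_tail.
Qed.

Lemma one_subX (r : R) n : 0 <= r <= 1 -> 0 <= 1 - r ^+ n <= n%:R * (1 - r).
Proof.
move=> /andP[r0 r1]; have rn := exprn_ile1 n r0 r1.
apply/andP; split; first by lra.
elim: n {rn} => [|n IH]; first by rewrite expr0 subrr mul0r.
rewrite exprS -natr1.
have rn := exprn_ile1 n r0 r1; have rn0 := exprn_ge0 n r0; nra.
Qed.

End PolyLimits.

(** * Construction of the weight *)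

Section Construction.
Variable R : realType.
Variables (phi wv : R[i] -> R[i]) (g : nat -> nat -> R[i]) (M0 : R) (m : nat).
Hypothesis phiD : forall z, inD z -> inD (phi z).
Hypothesis gval : forall n z, inD z -> H2val (g n) z (wv z * phi z ^+ n).
Hypothesis gM0 : forall N K, \sum_(n < N) sqpart (g n) K <= M0.
Hypothesis gm : g 0 m != 0.
Hypothesis gm0 : forall i, (i < m)%N -> g 0 i = 0.

Let B : R := Num.sqrt M0.
(** Radii tending to 1, paired below with regularisations [eta k] tending to 0. The shift by two
    keeps every radius at least one half. *)
Let rr (k : nat) : R := 1 - k.+2%:R^-1.
Let eta (k : nat) : R := k.+1%:R^-1.

Lemma sqpart_ge0 (f : nat -> R[i]) K : 0 <= sqpart f K.
Proof. by apply: sumr_ge0 => i _; exact: sqr_ge0. Qed.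

Lemma M0_ge0 : 0 <= M0.
Proof. by have := gM0 0 0; rewrite big_ord0. Qed.

Lemma g_sqpart n K : sqpart (g n) K <= M0.
Proof.
apply: le_trans (gM0 n.+1 K); rewrite big_ord_recr /= lerDr sumr_ge0 // => i _.
exact: sqpart_ge0.
Qed.

Lemma g_coef n i : cmod (g n i) <= B.
Proof.
apply: sqpart_coef_le; first exact: sqrtr_ge0.
by move=> N; rewrite sqr_sqrtr ?M0_ge0 // g_sqpart.
Qed.

Lemma rr_ge k : 2^-1 <= rr k.
Proof.
rewrite /rr; have : k.+2%:R^-1 <= 2^-1 :> R by rewrite lef_pV2 ?posrE ?ltr0n ?ler_nat.
by move: (k.+2%:R^-1 : R) => x; lra.
Qed.
Lemma rr_lt1 k : rr k < 1. Proof. by rewrite ltrBlDr ltrDl invr_gt0 ltr0n. Qed.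
Lemma rr_ge0 k : 0 <= rr k. Proof. by have := rr_ge k; lra. Qed.
Lemma eta_gt0 k : 0 < eta k. Proof. by rewrite invr_gt0 ltr0n. Qed.
Lemma eta_le1 k : eta k <= 1. Proof. by rewrite invf_le1 ?ltr0n ?ler1n. Qed.

Lemma cmod_dil k z : cmod z = 1 -> cmod ((rr k)%:C%C * z) = rr k.
Proof. by move=> z1; rewrite cmodM z1 mulr1 cmod_real ger0_norm ?rr_ge0. Qed.

Lemma dilD k z : cmod z = 1 -> inD ((rr k)%:C%C * z).
Proof. by move=> z1; rewrite /inD cmod_dil ?rr_lt1. Qed.

Definition gdil k n z : R[i] := wv ((rr k)%:C%C * z) * phi ((rr k)%:C%C * z) ^+ n.

Definition gpoly k n d : {poly R[i]} := \poly_(i < d) (g n i * (rr k)%:C%C ^+ i).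

Lemma gpoly_psum k n d z : (gpoly k n d).[z] = psum (g n) ((rr k)%:C%C * z) d.
Proof.
rewrite /gpoly horner_poly; apply: eq_bigr => i _.
by rewrite exprMn mulrA.
Qed.

(** The degree [D] is independent of [n] because all [g n] share the coefficient bound [B]. *)
Lemma gpoly_approx k (e : R) : 0 < e -> exists D, forall n d z, (D <= d)%N ->
  cmod z = 1 -> cmod (gdil k n z - (gpoly k n d).[z]) <= e.
Proof.
move=> e0; have r1 := rr_lt1 k; have r0 := rr_ge0 k.
have B0 : 0 <= B by exact: sqrtr_ge0.
have c0 : 0 < e * (1 - rr k) / (B + 1).
  by apply: divr_gt0; [apply: mulr_gt0 => //; lra|lra].
have [D hD] := expr_small r0 r1 c0; exists D => n d z Dd z1.
have := H2val_tail d (g_coef n) (dilD k z1) (gval n (dilD k z1)).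
rewrite gpoly_psum (cmod_dil k z1) => h; apply: (le_trans h).
have {h} := hD d Dd; rewrite ler_pdivlMr => [h|]; last by lra.
rewrite mulrA ler_pdivrMr; last by lra.
have := exprn_ge0 d r0; nra.
Qed.

Lemma gpoly_sq k n d : cmean (fun z => cmod (gpoly k n d).[z] ^+ 2) <= sqpart (g n) d.
Proof.
rewrite (@cmean_cmod_poly _ d); last exact: size_poly.
apply: ler_sum => i _; rewrite coef_poly ltn_ord cmodM cmodX cmod_real.
rewrite ger0_norm ?rr_ge0 // exprMn -[leRHS]mulr1 ler_wpM2l ?sqr_ge0 //.
by rewrite -exprM exprn_ile1 ?rr_ge0 // ltW ?rr_lt1.
Qed.

Lemma gdil_trig k n : trig_approx (fun z => cmod (gdil k n z) ^+ 2).
Proof.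
have reT : trig_approx (fun z => cre (gdil k n z)).
  apply: trig_approx_lim => e /(gpoly_approx k) [D hD].
  exists (fun z => cre (gpoly k n D).[z]); split; first exact: trig_approx_poly.
  by move=> z /(hD n D z (leqnn D)); apply: le_trans; rewrite -creB; exact: cre_le.
have imT : trig_approx (fun z => cim (gdil k n z)).
  apply: trig_approx_lim => e /(gpoly_approx k) [D hD].
  (* Multiplication by [-i] turns the imaginary part into a real part. *)
  exists (fun z => cre ((Complex 0 (-1)) *: gpoly k n D).[z]); split; first exact: trig_approx_poly.
  move=> z /(hD n D z (leqnn D)); apply: le_trans.
  by rewrite hornerZ creM /= mul0r sub0r mulN1r opprK -cimB; exact: cim_le.
under eq_fun do rewrite cmod_sq.
by apply: trig_approxD; exact: trig_approxX.
Qed.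

Let xx k z : R := cmod (wv ((rr k)%:C%C * z)) ^+ 2.
Let tt k z : R := cmod (phi ((rr k)%:C%C * z)) ^+ 2.

Definition wt k N z : R := wsum (eta k) (xx k z) (tt k z) N.

Lemma gdil_sq k n z : cmod (gdil k n z) ^+ 2 = xx k z * tt k z ^+ n.
Proof. by rewrite /gdil cmodM cmodX exprMn /xx /tt exprAC. Qed.

Lemma xx_ge0 k z : 0 <= xx k z. Proof. exact: sqr_ge0. Qed.
Lemma tt_ge0 k z : 0 <= tt k z. Proof. exact: sqr_ge0. Qed.
Lemma tt_01 k z : cmod z = 1 -> 0 <= tt k z <= 1.
Proof.
move=> z1; rewrite tt_ge0 /=; apply: exprn_ile1; first exact: cmod_ge0.
by have := phiD (dilD k z1); rewrite /inD => /ltW.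
Qed.

Lemma wtE k N z : wt k N z = eta k + \sum_(n < N.+1) cmod (gdil k n z) ^+ 2.
Proof.
by rewrite /wt /wsum mulr_sumr; congr (_ + _); apply: eq_bigr => n _; rewrite gdil_sq.
Qed.

Lemma wt_ge k N z : eta k <= wt k N z.
Proof. exact: wsum_ge (xx_ge0 k z) (tt_ge0 k z). Qed.
Lemma wt_gt0 k N z : 0 < wt k N z.
Proof. exact: lt_le_trans (eta_gt0 k) (wt_ge k N z). Qed.

Lemma wt_trig k N : trig_approx (wt k N).
Proof.
have -> : wt k N = fun z => eta k + \sum_(n < N.+1) cmod (gdil k n z) ^+ 2.
  by apply/funext => z; exact: wtE.
apply: trig_approxD; first exact: trig_approx_cst.
apply: (@trig_approx_sum _ N.+1 (fun n z => cmod (gdil k n z) ^+ 2)) => n.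
exact: gdil_trig.
Qed.

Lemma lnwt_trig k N : trig_approx (fun z => ln (wt k N z)).
Proof.
have [b hb] := trig_approx_bounded (wt_trig k N).
apply: (@trig_approx_ln _ _ (eta k) b); [exact: eta_gt0| |exact: wt_trig].
by move=> z /hb h; rewrite wt_ge /= (le_trans (ler_norm _) h).
Qed.

Definition lmean k N : R := cmean (fun z => ln (wt k N z)).

Lemma lnwt_mono k z : {homo (fun N => ln (wt k N z)) : a b / (a <= b)%N >-> a <= b}.
Proof.
move=> a b ab; rewrite ler_ln ?posrE ?wt_gt0 //.
by apply: wsum_mono => //; [exact: xx_ge0|exact: tt_ge0].
Qed.

Lemma lmean_mono k : {homo lmean k : a b / (a <= b)%N >-> a <= b}.
Proof.
move=> a b ab; apply: cmean_le; try exact/trig_approx_bounded/lnwt_trig.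
by move=> z _; exact: lnwt_mono.
Qed.

(** [ln] lies below the identity, so the mean of the weight is a bound. In it [eta k] costs at most
    1, replacing [N.+1] functions by polynomials with error [N.+1%:R^-1] at most 2, and Parseval
    gives [2 * M0]. *)
Lemma lmean_le k N : lmean k N <= 3 + 2 * M0.
Proof.
have e0 : 0 < N.+1%:R^-1 :> R by rewrite invr_gt0 ltr0n.
have [D hD] := gpoly_approx k e0.
pose F n z : R := 2 * cmod (gpoly k n D).[z] ^+ 2.
have bF n : bounded_circle (F n).
  by apply: bounded_circleZ; exact: bounded_circle_cmod.
have [bS eS] := cmean_sum (index_enum 'I_N.+1) (fun n : 'I_N.+1 => bF n).
apply: (@le_trans _ _ (cmean (fun z => 3 + \sum_(n < N.+1) F n z))).
  apply: cmean_le; first exact/trig_approx_bounded/lnwt_trig.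
    by apply: bounded_circleD => //; exact: bounded_circle_cst.
  move=> z z1; apply: (le_trans (ltW (ln_sublinear (wt_gt0 _ _ _)))).
  rewrite wtE.
  have h : \sum_(n < N.+1) cmod (gdil k n z) ^+ 2 <=
     \sum_(n < N.+1) (F n z + 2 * (N.+1%:R^-1) ^+ 2).
    apply: ler_sum => n _.
    have -> : gdil k n z = (gpoly k n D).[z] + (gdil k n z - (gpoly k n D).[z]) by ring.
    apply: (le_trans (cmod_sqD _ _)); rewrite lerD2l ler_pM2l ?ltr0n //.
    by apply: lerXn2r; rewrite ?nnegrE ?cmod_ge0 ?hD // ltW.
  rewrite big_split /= sumr_const card_ord in h.
  have h2 : (2 * (N.+1%:R^-1) ^+ 2) *+ N.+1 <= 2 :> R.
    rewrite -mulr_natl expr2 [2 * _]mulrC !mulrA mulfV ?pnatr_eq0 // mul1r.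
    by rewrite ler_piMl // invf_le1 ?ltr0n ?ler1n.
  by apply: le_trans (lerD (eta_le1 k) (le_trans h (lerD (lexx _) h2))) _; lra.
rewrite cmeanD //; last exact: bounded_circle_cst.
rewrite cmean_cst lerD2l eS.
have h1 : \sum_(n < N.+1) cmean (F n) <= \sum_(n < N.+1) 2 * sqpart (g n) D.
  apply: ler_sum => n _; rewrite cmeanZ; last exact: bounded_circle_cmod.
  by rewrite ler_pM2l ?ltr0n // gpoly_sq.
by apply: (le_trans h1); rewrite -mulr_sumr ler_pM2l ?ltr0n.
Qed.

Lemma coef_low (f : {poly R[i]}) k d : f`_0 = 1 -> (m < d)%N ->
  (f * gpoly k 0 d)`_m = g 0 m * (rr k)%:C%C ^+ m.
Proof.
move=> f0 md; rewrite coefM big_ord_recl /= f0 mul1r subn0 coef_poly md big1 ?addr0 //.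
move=> i _; rewrite coef_poly gm0 ?mul0r ?if_same ?mulr0 //.
by rewrite /bump /=; have := ltn_ord i; lia.
Qed.

(** Jensen's inequality through the Szego polynomial [f] of [ln (wt k 0)]: on the circle, [f] times
    the truncated [g 0] has squared modulus at most [2 * expR (lmean k 0 + 1)], while by [coef_low]
    its coefficient [m] is independent of [f]. *)
Lemma lmean_ge : exists c : R, forall k N, c <= lmean k N.
Proof.
(* The powers of one half come from [rr k >= 2^-1] and make the bound uniform in [k]. *)
pose kap : R := cmod (g 0 m) ^+ 2 * (2^-1) ^+ (m * 2) / 2.
have kap0 : 0 < kap.
  rewrite divr_gt0 // mulr_gt0 ?exprn_gt0 ?invr_gt0 //.
  rewrite lt0r cmod_ge0 andbT; apply: contra_neq gm => /cmod_eq0; exact.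
exists (ln kap - 1) => k N; apply: le_trans (lmean_mono k (leq0n N)).
rewrite lerBlDr -[leRHS]expRK ler_ln ?posrE ?expR_gt0 //.
have [f [f0 hf]] := szego_poly (lnwt_trig k 0) (@ltr01 R).
have [D hD] := gpoly_approx k (eta_gt0 k).
pose d := maxn D m.+1.
have hT z : cmod z = 1 -> cmod (f * gpoly k 0 d).[z] ^+ 2 <= 2 * expR (lmean k 0 + 1).
  move=> z1; rewrite hornerM cmodM exprMn.
  have h1 : cmod (gpoly k 0 d).[z] ^+ 2 <= 2 * wt k 0 z.
    have -> : (gpoly k 0 d).[z] = gdil k 0 z + ((gpoly k 0 d).[z] - gdil k 0 z) by ring.
    apply: (le_trans (cmod_sqD _ _)); rewrite wtE big_ord1 mulrDr addrC lerD2r ler_pM2l ?ltr0n //.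
    rewrite cmodB; apply: (@le_trans _ _ (eta k ^+ 2)).
      apply: lerXn2r; rewrite ?nnegrE ?cmod_ge0 ?(ltW (eta_gt0 k)) //.
      by apply: hD => //; exact: leq_maxl.
    by rewrite expr2 ger_pMl ?eta_gt0 ?eta_le1.
  apply: (@le_trans _ _ (expR (lmean k 0 - ln (wt k 0 z) + 1) * (2 * wt k 0 z))).
    by apply: ler_pM; rewrite ?sqr_ge0 // hf.
  rewrite -{2}(@lnK _ (wt k 0 z)) ?posrE ?wt_gt0 // mulrCA -expRD.
  by rewrite ler_pM2l ?ltr0n // ler_expR; lra.
have hb := bessel_poly m.+1 hT.
have {hb} : cmod (f * gpoly k 0 d)`_m ^+ 2 <= 2 * expR (lmean k 0 + 1).
  apply: le_trans hb; rewrite big_ord_recr /= lerDr sumr_ge0 // => i _; exact: sqr_ge0.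
rewrite coef_low // ?leq_maxr // cmodM cmodX cmod_real ger0_norm ?rr_ge0 // exprMn -exprM.
rewrite /kap ler_pdivrMr ?ltr0n // [leRHS]mulrC; apply: le_trans.
apply: ler_wpM2l; first exact: sqr_ge0.
by apply: lerXn2r; rewrite ?nnegrE ?rr_ge0 ?invr_ge0 ?ler0n ?rr_ge.
Qed.

Lemma lmean_bounded N : seq_bounded (fun k => lmean k N).
Proof.
have [c hc] := lmean_ge; exists (`|c| + (3 + 2 * M0)) => k.
rewrite ler_norml; have := hc k N; have := lmean_le k N; have := M0_ge0.
have := ler_norm (- c); have := ler_norm c; rewrite normrN.
by move=> *; apply/andP; split; lra.
Qed.

Definition llim N : R := ulim (fun k => lmean k N).

Lemma llim_mono : {homo llim : a b / (a <= b)%N >-> a <= b}.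
Proof.
move=> a b ab; apply: ulim_le; try exact: lmean_bounded.
by apply: nearW => k; exact: lmean_mono.
Qed.

Lemma llim_le N : llim N <= 3 + 2 * M0.
Proof.
rewrite -[leRHS]ulim_cst; apply: ulim_le; [exact: lmean_bounded|exact: seq_bounded_cst|].
by apply: nearW => k; exact: lmean_le.
Qed.

Lemma llim_tail (e : R) : 0 < e -> exists N0, forall N, llim N <= llim N0 + e.
Proof.
move=> e0; have hs : has_sup (range llim).
  by split; [exists (llim 0), 0|exists (3 + 2 * M0) => _ [N _ <-]; exact: llim_le].
have [_ [N0 _ <-] h] := sup_adherent e0 hs; exists N0 => N.
have : llim N <= sup (range llim) by apply: ub_le_sup; [case: hs|exists N].
lra.
Qed.

(** The indices from [llim_tail] are summed, each increased by one, to be monotone and at least [i];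
    [llim_mono] carries the tail estimate over to the larger index. *)
Lemma index_seq : exists Ns : nat -> nat, {homo Ns : a b / (a <= b)%N} /\
  (forall i, (i <= Ns i)%N) /\
  forall i N, llim N <= llim (Ns i) + (2^-1) ^+ i.+1.
Proof.
have h i : exists N0, forall N, llim N <= llim N0 + (2^-1) ^+ i.+1.
  by apply: llim_tail; rewrite exprn_gt0 // invr_gt0.
have [n0 hn0] := choice h.
pose Ns i := (\sum_(j < i.+1) (n0 j).+1)%N; exists Ns.
have NsS i : Ns i.+1 = (Ns i + (n0 i.+1).+1)%N by rewrite /Ns big_ord_recr.
have n0Ns i : (n0 i <= Ns i)%N by rewrite /Ns big_ord_recr /=; lia.
split; [|split] => [|i|i N].
- apply: homo_leq => [//|b a c|i]; first exact: leq_trans.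
  by rewrite NsS leq_addr.
- elim: i => [//|i IH]; rewrite NsS; lia.
apply: (le_trans (hn0 i N)); rewrite lerD2r; exact: llim_mono.
Qed.

Lemma half_sum I : \sum_(i < I) (2^-1 : R) ^+ i.+1 <= 1.
Proof.
have -> : \sum_(i < I) (2^-1 : R) ^+ i.+1 = 1 - (2^-1) ^+ I.
  elim: I => [|I IH]; first by rewrite big_ord0 expr0 subrr.
  by rewrite big_ord_recr /= IH exprS; field.
by rewrite gerBl exprn_ge0 // invr_ge0.
Qed.

(** * Szego polynomials for the products of ratios, and passage to the limit *)

Section Steps.
Variable Ns : nat -> nat.
Hypothesis Ns_mono : {homo Ns : a b / (a <= b)%N}.
Hypothesis Ns_ge : forall i, (i <= Ns i)%N.
Hypothesis Ns_tail : forall i N, llim N <= llim (Ns i) + (2^-1) ^+ i.+1.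

(** [szego_poly] is applied to minus the logarithm of the product. By [Ns_tail] and [half_sum] the
    limit of its means is at most 1, so some [k >= I] has mean below 2; the slack 1 of [szego_poly]
    then gives [expR 3]. *)
Lemma szego_step I : exists kf : nat * {poly R[i]}, (I <= kf.1)%N /\ kf.2`_0 = 1 /\
  forall z, cmod z = 1 -> cmod kf.2.[z] ^+ 2 <=
    expR 3 * \prod_(i < I) (wt kf.1 (Ns i) z / wt kf.1 (Ns I) z).
Proof.
pose u k z := \sum_(i < I) (ln (wt k (Ns I) z) + -1 * ln (wt k (Ns i) z)).
have ut k i : trig_approx (fun z => ln (wt k (Ns I) z) + -1 * ln (wt k (Ns i) z)).
  by apply: trig_approxD; [|apply: trig_approxZ]; exact: lnwt_trig.
have uT k : trig_approx (u k).
  exact: (@trig_approx_sum _ I (fun i z => ln (wt k (Ns I) z) + -1 * ln (wt k (Ns i) z))).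
have um k : cmean (u k) = \sum_(i < I) (lmean k (Ns I) + -1 * lmean k (Ns i)).
  have [_ ->] := cmean_sum (index_enum 'I_I) (fun i : 'I_I => trig_approx_bounded (ut k i)).
  have bl N : bounded_circle (fun z => ln (wt k N z)).
    exact/trig_approx_bounded/lnwt_trig.
  by apply: eq_bigr => i _; rewrite cmeanD ?cmeanZ //; exact: bounded_circleZ.
have bl i : seq_bounded (fun k => lmean k (Ns I) + -1 * lmean k (Ns i)).
  by apply: seq_boundedD; [|apply: seq_boundedZ]; exact: lmean_bounded.
have gen J :
    seq_bounded (fun k => \sum_(i < J) (lmean k (Ns I) + -1 * lmean k (Ns i))) /\
    ulim (fun k => \sum_(i < J) (lmean k (Ns I) + -1 * lmean k (Ns i))) =
    \sum_(i < J) (llim (Ns I) - llim (Ns i)).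
  elim: J => [|J [IHb IHe]].
    under eq_fun do rewrite big_ord0.
    by rewrite big_ord0 ulim_cst; split => //; exact: seq_bounded_cst.
  under eq_fun do rewrite big_ord_recr /=.
  rewrite big_ord_recr /= ulimD // IHe; split; first exact: seq_boundedD.
  by rewrite ulimD ?ulimZ ?mulN1r //; try (apply: seq_boundedZ); exact: lmean_bounded.
have [bu eu] : seq_bounded (fun k => cmean (u k)) /\
    ulim (fun k => cmean (u k)) = \sum_(i < I) (llim (Ns I) - llim (Ns i)).
  by under eq_fun do rewrite um; exact: gen.
have lt2 : ulim (fun k => cmean (u k)) < 2.
  rewrite eu; apply: (@le_lt_trans _ _ 1); last by lra.
  apply: le_trans (half_sum I); apply: ler_sum => i _.
  by have := Ns_tail i (Ns I); lra.
have [k [Ik ku]] := ulim_near I bu lt2.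
have [f [f0 hf]] := szego_poly (uT k) (@ltr01 R).
exists (k, f); split => //; split => // z z1 /=.
apply: (le_trans (hf z z1)).
have -> : \prod_(i < I) (wt k (Ns i) z / wt k (Ns I) z) = expR (- u k z).
  rewrite /u -sumrN expR_sum; apply: eq_bigr => i _.
  rewrite opprD mulN1r opprK addrC expRD expRN !lnK ?posrE ?wt_gt0 //.
by rewrite -expRD ler_expR; lra.
Qed.

Let K_ j : R := \prod_(i < j) (2 * (Ns i).+1%:R).
Let E3 : R := expR 3.

Lemma K_ge0 j : 0 <= K_ j.
Proof. by apply: prodr_ge0 => i _; rewrite mulr_ge0. Qed.

Lemma prod_wt_le1 I k z : \prod_(i < I) (wt k (Ns i) z / wt k (Ns I) z) <= 1.
Proof.
apply: prodr_ile1 => i _; rewrite divr_ge0 ?(ltW (wt_gt0 _ _ _)) //=.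
rewrite ler_pdivrMr ?wt_gt0 // mul1r.
by apply: wsum_mono; rewrite ?xx_ge0 ?tt_ge0 //; apply: Ns_mono; exact: ltnW.
Qed.

(** [prod_wsum_ratio] bounds the squared modulus of the product pointwise by a multiple of that of
    [gpoly k 0 d], whose mean is at most [M0]; Bessel returns to coefficients. The factor 4 comes
    from two uses of [cmod_sqD], and the terms in [e] absorb the truncation errors and [eta k]. *)
Lemma product_bound I k (f : {poly R[i]}) d (e : R) j n M K :
  (forall z, cmod z = 1 -> cmod f.[z] ^+ 2 <=
    E3 * \prod_(i < I) (wt k (Ns i) z / wt k (Ns I) z)) ->
  (forall n z, cmod z = 1 -> cmod (gdil k n z - (gpoly k n d).[z]) <= e) ->
  eta k <= e -> e <= 1 ->
  (j <= I)%N -> (n <= Ns I)%N -> (n * j <= M)%N ->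
  sqpart (fun i => (f * gpoly k M d)`_i) K <=
    4 * E3 * K_ j * M0 / n.+1%:R ^+ j + 4 * E3 * (K_ j + 1) * e.
Proof.
move=> hf hd ee e1 jI nI njM.
have E0 : 0 < E3 by exact: expR_gt0.
have K0 := K_ge0 j; have e0 := lt_le_trans (eta_gt0 k) ee.
pose nj : R := (n.+1%:R ^+ j)^-1.
have nj0 : 0 <= nj by rewrite invr_ge0 exprn_ge0.
have nj1 : nj <= 1 by rewrite invf_le1 ?exprn_gt0 ?ltr0n // exprn_ege1 // ler1n.
have e2 : e ^+ 2 <= e by rewrite expr2 ger_pMl.
have e20 : 0 <= e ^+ 2 by exact: sqr_ge0.
pose c1 := 4 * E3 * K_ j * nj; pose c2 := 4 * E3 * (K_ j + 1) * e.
have c10 : 0 <= c1 by rewrite !mulr_ge0 // ltW.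
have pw z : cmod z = 1 -> cmod (f * gpoly k M d).[z] ^+ 2 <=
    c1 * cmod (gpoly k 0 d).[z] ^+ 2 + c2.
  move=> z1; rewrite hornerM cmodM exprMn.
  set F := cmod f.[z] ^+ 2; have F0 : 0 <= F by exact: sqr_ge0.
  set G := cmod (gpoly k M d).[z] ^+ 2; set G0 := cmod (gpoly k 0 d).[z] ^+ 2.
  set x := xx k z; set t := tt k z.
  have x0 : 0 <= x by exact: xx_ge0.
  have de n' : cmod (gdil k n' z - (gpoly k n' d).[z]) ^+ 2 <= e ^+ 2.
    by apply: lerXn2r; rewrite ?nnegrE ?cmod_ge0 ?hd // ltW.
  have hG : G <= 2 * (x * t ^+ M) + 2 * e ^+ 2.
    rewrite /G (_ : (gpoly k M d).[z] = gdil k M z - (gdil k M z - (gpoly k M d).[z])); last by ring.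
    by apply: (le_trans (cmod_sqD _ _)); rewrite cmodN gdil_sq lerD2l ler_pM2l ?ltr0n // de.
  have hx : x <= 2 * G0 + 2 * e ^+ 2.
    have -> : x = cmod (gdil k 0 z) ^+ 2 by rewrite gdil_sq expr0 mulr1.
    rewrite (_ : gdil k 0 z = (gpoly k 0 d).[z] + (gdil k 0 z - (gpoly k 0 d).[z])); last by ring.
    by apply: (le_trans (cmod_sqD _ _)); rewrite lerD2l ler_pM2l ?ltr0n // de.
  have FE : F <= E3 by apply: (le_trans (hf z z1)); rewrite ger_pMr // prod_wt_le1.
  have hFx : F * (x * t ^+ M) <= E3 * (K_ j * x * nj + eta k).
    have xt0 : 0 <= x * t ^+ M by apply: mulr_ge0 => //; apply: exprn_ge0; exact: tt_ge0.
    apply: (le_trans (ler_wpM2r xt0 (hf z z1))).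
    rewrite -[leLHS]mulrA ler_pM2l // [leLHS]mulrC.
    exact: (prod_wsum_ratio (eta_gt0 k) x0 (tt_01 k z1) Ns_mono jI nI njM).
  have s1 : F * G <= 2 * (F * (x * t ^+ M)) + 2 * (E3 * e ^+ 2).
    apply: (@le_trans _ _ (F * (2 * (x * t ^+ M) + 2 * e ^+ 2))); first exact: ler_wpM2l.
    rewrite mulrDr mulrCA lerD2l mulrCA ler_pM2l ?ltr0n //.
    by rewrite ler_wpM2r.
  have s2 : K_ j * x * nj <= K_ j * (2 * G0) * nj + 2 * (K_ j * e).
    apply: (@le_trans _ _ (K_ j * (2 * G0 + 2 * e ^+ 2) * nj)).
      by rewrite ler_wpM2r // ler_wpM2l.
    rewrite mulrDr mulrDl lerD2l [X in X * nj]mulrCA -mulrA ler_pM2l ?ltr0n //.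
    by rewrite -mulrA ler_wpM2l // (le_trans _ e2) // ger_pMr // exprn_gt0.
  apply: (le_trans s1); apply: (@le_trans _ _
     (2 * (E3 * (K_ j * (2 * G0) * nj + 2 * (K_ j * e) + e)) + 2 * (E3 * e))).
    apply: lerD; last by rewrite ler_pM2l ?ltr0n // ler_pM2l.
    rewrite ler_pM2l ?ltr0n //; apply: (le_trans hFx); rewrite ler_pM2l //.
    by apply: lerD.
  by rewrite /c1 /c2 le_eqVlt; apply/orP; left; apply/eqP; ring.
apply: (le_trans (bessel_cmean _ _)).
have b0 : bounded_circle (fun z => c1 * cmod (gpoly k 0 d).[z] ^+ 2).
  by apply: bounded_circleZ; exact: bounded_circle_cmod.
apply: (@le_trans _ _ (cmean (fun z => c1 * cmod (gpoly k 0 d).[z] ^+ 2 + c2))).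
  apply: cmean_le => //; first exact: bounded_circle_cmod.
  by apply: bounded_circleD => //; exact: bounded_circle_cst.
rewrite cmeanD //; last exact: bounded_circle_cst.
rewrite cmean_cst cmeanZ; last exact: bounded_circle_cmod.
rewrite lerD2r (_ : 4 * E3 * K_ j * M0 / _ = c1 * M0); last by rewrite /c1 mulrAC.
apply: ler_wpM2l => //; exact: le_trans (gpoly_sq _ _ _) (g_sqpart _ _).
Qed.

(** [h M] is the coefficientwise limit of the polynomials of [szego_step] times the dilated and
    truncated [g M]. Bounds uniform in [I] pass to the limit, and the normalisation at 0 keeps it
    nonzero. *)
Lemma weights_exist : exists (h : nat -> nat -> R[i]) (hv : R[i] -> R[i]),
  [/\ forall n z, inD z -> H2val (h n) z (hv z * phi z ^+ n),
      forall q : nat, exists C : R, 0 <= C /\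
        forall n K, sqpart (h n) K <= C / n.+1%:R ^+ q &
      h 0 m != 0].
Proof.
have [kf hkf] := choice szego_step.
pose k I := (kf I).1; pose f I := (kf I).2.
have kI I : (I <= k I)%N by have [] := hkf I.
have f0 I : (f I)`_0 = 1 by have [_ []] := hkf I.
have hf I z : cmod z = 1 -> cmod (f I).[z] ^+ 2 <=
    E3 * \prod_(i < I) (wt (k I) (Ns i) z / wt (k I) (Ns I) z).
  by have [_ [_]] := hkf I; apply.
pose e I : R := I.+1%:R^-1.
have e0 I : 0 < e I by rewrite invr_gt0 ltr0n.
have e1 I : e I <= 1 by rewrite invf_le1 ?ltr0n ?ler1n.
have ee I : eta (k I) <= e I by rewrite lef_pV2 ?posrE ?ltr0n // ler_nat ltnS.
have [D hD] := choice (fun I => gpoly_approx (k I) (e0 I)).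
(* [D I] gives the approximation, [m.+1] retains the coefficient of index [m], and [I] makes every
   fixed coefficient survive truncation eventually. *)
pose d I := (D I + (m.+1 + I))%N.
have hd I n z : cmod z = 1 -> cmod (gdil (k I) n z - (gpoly (k I) n (d I)).[z]) <= e I.
  by move=> z1; apply: hD => //; exact: leq_addr.
have E0 : 0 < E3 by exact: expR_gt0.
pose G I n := gpoly (k I) n (d I); pose P I n := f I * G I n.
have bound I j n M K : (j <= I)%N -> (n <= Ns I)%N -> (n * j <= M)%N ->
    sqpart (fun i => (P I M)`_i) K <=
    4 * E3 * K_ j * M0 / n.+1%:R ^+ j + 4 * E3 * (K_ j + 1) * e I.
  by move=> *; apply: (product_bound _ (hf I) (hd I)).
(* The case [j = n = 0] of [bound], with [e I <= 1]: a bound uniform in [I] and [M]. *)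
pose BP : R := 4 * E3 * K_ 0 * M0 + 4 * E3 * (K_ 0 + 1).
have BP0 : 0 <= BP.
  by rewrite addr_ge0 // !mulr_ge0 ?addr_ge0 ?K_ge0 ?M0_ge0 // ltW.
have Pco I M i : cmod (P I M)`_i <= Num.sqrt BP.
  apply: (@sqpart_coef_le _ (fun i => (P I M)`_i)); first exact: sqrtr_ge0.
  move=> K; rewrite sqr_sqrtr //; apply: (le_trans (@bound I 0 0 M K _ _ _)) => //.
  rewrite expr0 divr1 lerD2l -[leRHS]mulr1 ler_wpM2l //.
  by rewrite !mulr_ge0 ?addr_ge0 ?K_ge0 // ltW.
have fco I i : cmod (f I)`_i <= Num.sqrt E3.
  apply: (@sqpart_coef_le _ (fun i => (f I)`_i)); first exact: sqrtr_ge0.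
  move=> K; rewrite sqr_sqrtr ?(ltW E0) //; apply: (@bessel_poly _ (f I) E3 K) => z z1.
  apply: (le_trans (hf I z z1)); by rewrite ger_pMr // prod_wt_le1.
have Gco I n i : cmod (G I n)`_i <= B.
  rewrite coef_poly; case: ifP => _; last by rewrite cmod0 sqrtr_ge0.
  rewrite cmodM cmodX cmod_real ger0_norm ?rr_ge0 // -[leRHS]mulr1.
  by apply: ler_pM; rewrite ?cmod_ge0 ?g_coef ?exprn_ge0 ?exprn_ile1 ?rr_ge0 // ltW ?rr_lt1.
have rdist i I : cmod ((rr (k I))%:C%C ^+ i - 1) <= i%:R * e I.
  rewrite cmodB -rmorphXn -(rmorph1 (real_complex R)) -rmorphB /=.
  rewrite cmod_real; have /andP[a b] : 0 <= 1 - rr (k I) ^+ i <= i%:R * (1 - rr (k I)).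
    by apply: one_subX; rewrite rr_ge0 ltW ?rr_lt1.
  rewrite ger0_norm //; apply: (le_trans b); rewrite ler_wpM2l //.
  by rewrite /rr subKr lef_pV2 ?posrE ?ltr0n // ler_nat; have := kI I; lia.
have Glim n i : culim (fun I => (G I n)`_i) = g n i.
  apply: culim_cvg; apply: (@squeeze_cvgr _ _ _ _ (fun=> 0) (fun I => B * (i%:R * e I))).
  - exists i => // I iI; rewrite cmod_ge0 /= coef_poly.
    have -> : (i < d I)%N by move: iI; rewrite /d /=; lia.
    rewrite -{2}[g n i]mulr1 -mulrBr cmodM.
    by apply: ler_pM; rewrite ?cmod_ge0 ?g_coef.
  - exact: cvg_cst.
  by do 2!apply: cvg0Z; exact: cvg_harmonic.
pose F z := culim (fun I => (f I).[z]).
exists (fun M i => culim (fun I => (P I M)`_i)), (fun z => F z * wv z); split.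
- move=> M z zD.
  have [_ hP] := H2val_culim (fun I => Pco I M) zD.
  (* The ultrafilter limit is multiplicative, so one factor [F z] serves all [M]. *)
  suff -> : F z * wv z * phi z ^+ M = culim (fun I => (P I M).[z]) by [].
  have [bf _] := H2val_culim fco zD.
  have [bG hG] := H2val_culim (fun I => Gco I M) zD.
  under [in RHS]eq_fun do rewrite hornerM; rewrite culimM // -mulrA; congr (_ * _).
  have gM := gval M zD.
  have eG : (fun i => culim (fun I => (G I M)`_i)) = g M by apply/funext => i.
  by rewrite eG in hG; exact: H2val_uniq gM hG.
- move=> q; exists (4 * E3 * K_ q * M0 * q%:R ^+ q).
  have C0 : 0 <= 4 * E3 * K_ q * M0 by rewrite !mulr_ge0 ?K_ge0 ?M0_ge0 // ltW.
  split=> [|M K]; first by rewrite mulr_ge0 ?exprn_ge0.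
  (* The largest [n] with [n * q <= M]; as [M.+1 <= q * n.+1] for positive [q], the change of
     variable costs the factor [q%:R ^+ q]. *)
  pose n := (M %/ q)%N.
  apply: (@le_trans _ _ (4 * E3 * K_ q * M0 / n.+1%:R ^+ q)).
    apply: (@culim_sqpart _ (fun I i => (P I M)`_i)
      (fun I => 4 * E3 * K_ q * M0 / n.+1%:R ^+ q + 4 * E3 * (K_ q + 1) * e I)).
    + by move=> i; exists (Num.sqrt BP) => I.
    + rewrite -[X in _ --> X]addr0; apply: cvgD; first exact: cvg_cst.
      by apply: cvg0Z; exact: cvg_harmonic.
    (* From this index on, [q <= I] and [n <= I <= Ns I]. *)
    exists (q + n)%N => // I qI; apply: bound.
    + by apply: leq_trans qI; exact: leq_addr.
    + by apply: leq_trans (Ns_ge I); apply: leq_trans qI; exact: leq_addl.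
    exact: leq_trunc_div.
  rewrite -[leRHS]mulrA ler_wpM2l // ler_pdivlMr ?exprn_gt0 ?ltr0n //.
  rewrite mulrC ler_pdivrMr ?exprn_gt0 ?ltr0n // -exprMn.
  case: (posnP q) => [->|q0]; first by rewrite !expr0.
  apply: lerXn2r; rewrite ?nnegrE ?mulr_ge0 // -natrM ler_nat /n.
  by rewrite mulnC; exact: ltn_ceil.
(* Each [f I] has constant coefficient 1 and [g 0] vanishes below [m], so multiplication by [f I]
   leaves the coefficient of index [m] unchanged. *)
have -> : culim (fun I => (P I 0)`_m) = g 0 m.
  rewrite -(Glim 0 m); congr culim; apply/funext => I.
  rewrite coef_low //; last by rewrite /d; lia.
  by rewrite coef_poly (_ : (m < d I)%N) //; rewrite /d; lia.
exact: gm.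
Qed.

End Steps.
End Construction.

(** * Images of the monomials *)

Section MonomialImages.
Variable R : realType.

Lemma sqpart_ebasis n N : sqpart (@ebasis R n) N <= 1.
Proof.
have [nN|Nn] := ltnP n N.
  rewrite /sqpart (bigD1 (Ordinal nN)) //= /ebasis eqxx cmod1 expr1n big1 ?addr0 //.
  move=> i ni; rewrite (_ : (i == n :> nat) = false) ?cmod0 ?expr0n //.
  by apply/negbTE; apply: contra_neq ni => ni; apply/val_inj.
rewrite /sqpart big1 // => i _; rewrite /ebasis ltn_eqF ?cmod0 ?expr0n //.
exact: leq_trans Nn.
Qed.

Lemma inH2_ebasis n : inH2 (@ebasis R n).
Proof. by exists 1 => N; exact: sqpart_ebasis. Qed.

Lemma H2val_ebasis n (z : R[i]) : H2val (ebasis n) z (z ^+ n).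
Proof.
apply/H2valP; apply: cvg_near_cst; exists n.+1 => // d /= nd.
rewrite /psum (bigD1 (Ordinal nd)) //= /ebasis eqxx mul1r big1 ?addr0 ?subrr ?cmod0 //.
move=> i ni; rewrite (_ : (i == n :> nat) = false) ?mul0r //.
by apply/negbTE; apply: contra_neq ni => ni; apply/val_inj.
Qed.

End MonomialImages.

Theorem theorem4p4 (R : realType) (phi : R[i] -> R[i]) :
  analytic_selfmap phi ->
  (exists w0 : nat -> R[i], inH2 w0 /\ (exists n, w0 n != 0) /\
     hilbert_schmidt (wcomp w0 phi)) ->
  exists w : nat -> R[i], inH2 w /\ (exists n, w n != 0) /\
    bounded_op (wcomp w phi) /\
    forall p : R, 0 < p -> p < 2 -> schatten p (wcomp w phi).
Proof.
move=> [_ phiD] [w0 [hw0 [w0n0 [[Mb hMb] [M hM]]]]].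
have /choice[wv hwv] : forall z, exists v, inD z -> H2val w0 z v.
  move=> z; have [zD|nzD] := pselect (inD z).
    by have [v hv] := H2val_exists (inH2_coef hw0) zD; exists v.
  by exists 0.
have /choice[g hg] : forall n, exists gn, wcomp w0 phi (ebasis n) gn.
  move=> n; have [gn [hgn _]] := hMb _ (@inH2_ebasis R n).
  by exists gn.
have gH n : inH2 (g n) by have [] := hg n.
have gval n z : inD z -> H2val (g n) z (wv z * phi z ^+ n).
  move=> zD; have [_ /(_ z zD) [fv [v [hfv [hv hgv]]]]] := hg n.
  by rewrite (H2val_uniq (hwv z zD) hv) (H2val_uniq (@H2val_ebasis R n _) hfv).
(* This is where the Hilbert-Schmidt bound enters, on the images of the monomials. *)
have gM0 N K : \sum_(n < N) sqpart (g n) K <= M.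
  by apply: le_trans (hM N g hg); apply: ler_sum => n _; exact: sqpart_le_norm.
have g0 : g 0 = w0.
  apply/funext => k; apply/eqP; rewrite -subr_eq0 -mulN1r addrC; apply/eqP.
  apply: (@identity_principle _ (fun k => -1 * w0 k + g 0 k) (H2norm w0 + H2norm (g 0))).
    by move=> j; apply: (le_trans (cmodD _ _)); rewrite mulN1r cmodN lerD ?inH2_coef.
  move=> z zD; have := H2val_lin (-1) (hwv z zD) (gval 0 z zD).
  by rewrite expr0 mulr1 mulN1r addNr.
(* [m] is the order of vanishing of [w0] at the origin. *)
have [m gm gmin] := ex_minnP w0n0.
have gm0 i : (i < m)%N -> g 0 i = 0.
  move=> im; rewrite g0; apply/eqP; apply: contraLR im => /gmin.
  by rewrite -leqNgt.
rewrite -g0 in gm.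
have [Ns [Ns_mono [Ns_ge Ns_tail]]] := index_seq gval gM0 gm gm0.
have [h [hv [hval hdecay hm]]] := weights_exist phiD gval gM0 gm gm0 Ns_mono Ns_ge Ns_tail.
exists (h 0); split.
  have [C [_ hC]] := hdecay 0; exists C => N.
  by have := hC 0 N; rewrite expr0 divr1.
split; first by exists m.
split; first exact: (bounded_wcomp phiD hval hdecay).
by move=> p p0 _; exact: (schatten_wcomp phiD hval hdecay).
Qed.
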